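(* The universal cover of an $SD_2^{\ast}(7)$ complex is Gromov hyperbolic.
   Context: Conventions: the complex is assumed connected; simplices are finite, and complexes are assumed to contain no infinite set of pairwise adjacent vertices. A complex is Gromov hyperbolic if its $1$-skeleton with the path metric is Gromov hyperbolic. $X$ is flag if every finite set of pairwise adjacent vertices spans a simplex. $B_1(v,X)$ is the full subcomplex spanned by $v$ and the vertices adjacent to $v$. Wheels: for $k\ge 4$ a $k$-wheel $(v_0;v_1,\dots,v_k)$ is a full subcomplex of $X$ such that $(v_1,\dots,v_k,v_1)$ is a full $k$-cycle (distinct vertices, cyclically consecutive ones adjacent, no other adjacencies among them) and $v_0$ is adjacent to all $v_1,\dots,v_k$. A $k$-wheel with a pendant triangle $(v_0;v_1,\dots,v_k;t)$ is the union of a $k$-wheel $(v_0;v_1,\dots,v_k)$ and a triangle $\langle v_1,v_2,t\rangle$ of $X$ with $t\ne v_i$ for $i=0,\dots,k$ (not required to be a full subcomplex). $SD_2^{\ast}(k)$ complex ($k\ge5$): a flag simplicial complex $X$ such that (a) $X$ contains no $4$-wheels; (b) for $5\le l<k$ and every $l$-wheel with a pendant triangle $\widehat W$ in $X$ there is a vertex $v$ with $\widehat W\subseteq B_1(v,X)$. *)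

(* Defs.v *)
From mathcomp Require Import all_boot all_order all_algebra finmap.
From mathcomp Require Import boolp classical_sets cardinality reals.

Set Implicit Arguments.
Unset Strict Implicit.
Unset Printing Implicit Defensive.

Import Order.TTheory GRing.Theory Num.Theory.

Local Open Scope fset_scope.
Local Open Scope classical_set_scope.

(* Abstract simplicial complexes; every element of V is a vertex. *)
Record complex (V : choiceType) := Complex {
  face :> {fset V} -> Prop;
  face_neq0 : forall s, face s -> s != fset0;
  face_vertex : forall v, face [fset v];
  face_sub : forall s t, face s -> (t `<=` s)%fset -> t != fset0 -> face t
}.

Section Complexes.
Variable V : choiceType.
Implicit Types (X : complex V) (u v w t : V) (s e : {fset V}) (c p q : seq V).

Definition adj X u v : Prop := u != v /\ X [fset u; v].

Definition flag X : Prop :=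
  forall s, s != fset0 ->
    (forall u v, u \in s -> v \in s -> u != v -> adj X u v) -> X s.

Definition no_infinite_clique X : Prop :=
  forall K : set V,
    (forall u v, K u -> K v -> u != v -> adj X u v) -> finite_set K.

Definition full_subcomplex X (A : set V) : set {fset V} :=
  [set s | X s /\ [set` s] `<=` A].

Definition ball1 X v : set {fset V} :=
  full_subcomplex X [set w | w = v \/ adj X v w].

(* [next c] is the cyclic successor in the sequence c. *)
Definition full_cycle X c : Prop :=
  uniq c /\
  forall x y, x \in c -> y \in c ->
    (adj X x y <-> y = next c x \/ x = next c y).

Definition wheel X v0 c : Prop :=
  [/\ (4 <= size c)%N, full_cycle X c & forall v, v \in c -> adj X v0 v].

(* The rim of the wheel is v1 :: v2 :: c. *)
Definition pendant_wheel X v0 v1 v2 c t : Prop :=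
  [/\ wheel X v0 [:: v1, v2 & c], X [fset v1; v2; t]
    & t \notin [:: v0, v1, v2 & c]].

Definition pendant_wheel_complex X v0 v1 v2 c t : set {fset V} :=
  full_subcomplex X [set` [:: v0, v1, v2 & c]] `|`
  full_subcomplex X [set` [:: v1; v2; t]].

Definition SD2star (k : nat) X : Prop :=
  [/\ flag X,
      (forall v0 c, size c = 4%N -> ~ wheel X v0 c)
    & forall l v0 v1 v2 c t,
        (5 <= l < k)%N -> size [:: v1, v2 & c] = l ->
        pendant_wheel X v0 v1 v2 c t ->
        exists v, pendant_wheel_complex X v0 v1 v2 c t `<=` ball1 X v].

(* Edge paths v :: p; consecutive vertices are allowed to be equal. *)
Fixpoint edge_path X v p : Prop :=
  if p is w :: q then X [fset v; w] /\ edge_path X w q else True.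

Definition connected X : Prop :=
  forall u v, exists2 p, edge_path X u p & last u p = v.

Inductive homotopic X : seq V -> seq V -> Prop :=
| homotopic_refl p : homotopic X p p
| homotopic_sym p q : homotopic X p q -> homotopic X q p
| homotopic_trans p q r :
    homotopic X p q -> homotopic X q r -> homotopic X p r
| homotopic_stutter p v q :
    homotopic X (p ++ [:: v, v & q]) (p ++ v :: q)
| homotopic_triangle p u v w q : X [fset u; v; w] ->
    homotopic X (p ++ [:: u, v, w & q]) (p ++ [:: u, w & q]).

(* Triviality of the edge-path group at every base vertex. *)
Definition simply_connected X : Prop :=
  connected X /\
  forall v p, edge_path X v p -> last v p = v -> homotopic X (v :: p) [:: v].

Definition closed_star X v : set {fset V} :=
  [set s | X s /\ X (v |` s)%fset].

End Complexes.

(* A simplicial map that restricts to an isomorphism from the closed star of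
   every vertex onto the closed star of its image: as p is injective on the
   vertices of the star of y, the last clause makes s |-> p(s) a bijection
   between the simplices of the two stars. *)
Definition covering (W V : choiceType) (Y : complex W) (X : complex V)
    (p : W -> V) : Prop :=
  [/\ forall s, Y s -> X (p @` s)%fset,
      forall v, exists y, p y = v,
      forall y w w', Y [fset y; w] -> Y [fset y; w'] -> p w = p w' -> w = w'
    & forall y, [set (p @` s)%fset | s in closed_star Y y]
                = closed_star X (p y)].

Definition universal_cover (W V : choiceType) (Y : complex W) (X : complex V)
    (p : W -> V) : Prop :=
  covering Y X p /\ simply_connected Y.

Local Open Scope ring_scope.

Section Hyperbolicity.
Variable R : realType.

Definition gromov_product (T : Type) (d : T -> T -> R) (w x y : T) : R :=
  (d w x + d w y - d x y) / 2.

Definition gromov_hyperbolic (T : Type) (S : set T) (d : T -> T -> R) : Prop :=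
  exists delta : R, forall x y z w, S x -> S y -> S z -> S w ->
    Num.min (gromov_product d w x y) (gromov_product d w y z) - delta
      <= gromov_product d w x z.

Variables (V : choiceType) (X : complex V).

Definition edge_or_vertex (e : {fset V}) : Prop := X e /\ (#|` e| <= 2)%N.

(* x is the family of barycentric coordinates of a point of the simplex s. *)
Definition barycentric (s : {fset V}) (x : V -> R) : Prop :=
  [/\ forall v, 0 <= x v, forall v, v \notin s -> x v = 0
    & \sum_(v <- s) x v = 1].

Definition skeleton1 : set (V -> R) :=
  [set x | exists2 e, edge_or_vertex e & barycentric e x].

(* Piecewise linear paths in the 1-skeleton, with their lengths. Edges have
   length 1: on an edge {u, v} both coordinates vary by the same amount, which
   is the length of the segment and half of the sum below. *)
Inductive skeleton1_path : (V -> R) -> (V -> R) -> R -> Prop :=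
| skeleton1_path_nil x : skeleton1_path x x 0
| skeleton1_path_cons e x y z l :
    edge_or_vertex e -> barycentric e x -> barycentric e y ->
    skeleton1_path y z l ->
    skeleton1_path x z ((\sum_(v <- e) `|x v - y v|) / 2 + l).

Definition path_metric (x y : V -> R) : R :=
  inf [set l | skeleton1_path x y l].

Definition hyperbolic_complex : Prop :=
  gromov_hyperbolic skeleton1 path_metric.

End Hyperbolicity.

(* Main.v *)
Require Import Defs.
From mathcomp Require Import all_boot all_order all_algebra finmap.
From mathcomp Require Import boolp classical_sets cardinality reals.
From mathcomp Require Import zify ring lra.

(** Let X be the complex with the local condition and Y its universal cover.

The condition only involves stars of vertices and triangles attached to them,
and a covering is an isomorphism on stars, so Y satisfies it too
([SD2star_cover]). For Y it has global consequences. Fix a vertex v of Y and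
build a complex around v layer by layer: from a point s of the last layer one
may step to any neighbour of its image that does not already lie in the image of
the star of s, and two such steps to the same vertex from adjacent points are
identified. The absence of 4-wheels and the domination of 5-wheels with a
pendant triangle make this identification transitive ([free_siblings_trans]) and
the map to Y an isomorphism on stars ([cover_step]). Hence edge paths of Y lift uniquely, lifts of homotopic
paths have the same end, and since Y is simply connected the map is a bijection
([tip_inj], [tip_surj]). The layers are then the spheres around v, which gives
two properties of distances in Y, for every v: adjacent vertices at the same
distance from v have a common neighbour that is closer ([triangle_condition]),
and the closer neighbours of a vertex are pairwise adjacent
([clique_condition]).

From these two properties one obtains that balls are convex ([ball_convex]).
Two configurations are then excluded by exhibiting in them a wheel with a pendant
triangle for which a dominating vertex would be a shortcut. First, if two
vertices of an interval at the same distance from its ends were not adjacent, the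
middle vertex of a path of length 2 inside that level would be the hub of a wheel
whose rim has length 4, 5 or 6; so intervals are 1-thin ([interval_thin]).
Second, a geodesic triangle whose sides only meet in its corners is equilateral,
and all points of a side are at the same distance from the opposite corner; if
its sides had length at least 3, the common closer neighbours under one side would
form a 5- or 6-wheel ([flat_side_small]). Any three vertices can be pushed along
geodesics to the corners of such a triangle ([quasi_median]), and together with
thin intervals this gives the four-point condition ([four_point]). Rims of length
6 occur in both arguments, and this is where the bound 7 is used.

Finally the length metric of the 1-skeleton differs from the distance between
nearby vertices by at most 2 ([path_metric_approx]), so the four-point condition
passes to it. *)

Set Implicit Arguments.
Unset Strict Implicit.
Unset Printing Implicit Defensive.

(** * Wheels in graphs and in complexes *)

Definition closed_nbr (T : Type) (A : T -> T -> Prop) x y := x = y \/ A x y.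

Section Wheels.
Variables (T : eqType) (A : T -> T -> Prop).

(** In positive form, so that it also applies to a rim whose opposite vertices
are not known to be distinct. *)
Definition no_4wheel := forall o a b c d,
  (forall x, x \in [:: a; b; c; d] -> A o x) ->
  A a b -> A b c -> A c d -> A d a -> closed_nbr A a c \/ closed_nbr A b d.

(** The pendant triangle lies on the rim edge a b. Asking t to differ from the hub
puts it off the wheel: no vertex of a full cycle of length at least 5 is adjacent
to two consecutive ones. *)
Definition dominated_5wheels := forall o a b c d e t,
  (forall x, x \in [:: a; b; c; d; e] -> A o x) ->
  A a b -> A b c -> A c d -> A d e -> A e a ->
  ~ A a c -> ~ A a d -> ~ A b d -> ~ A b e -> ~ A c e ->
  A a t -> A b t -> t <> o ->
  exists q, forall x, x \in [:: t; o; a; b; c; d; e] -> closed_nbr A q x.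

Definition dominated_6wheels := forall o a b c d e f t,
  (forall x, x \in [:: a; b; c; d; e; f] -> A o x) ->
  A a b -> A b c -> A c d -> A d e -> A e f -> A f a ->
  ~ A a c -> ~ A a d -> ~ A a e -> ~ A b d -> ~ A b e -> ~ A b f ->
  ~ A c e -> ~ A c f -> ~ A d f ->
  A a t -> A b t -> t <> o ->
  exists q, forall x, x \in [:: t; o; a; b; c; d; e; f] -> closed_nbr A q x.

End Wheels.

Lemma closed_nbr_sym T (A : T -> T -> Prop) x y :
  (forall x y, A x y -> A y x) -> closed_nbr A x y -> closed_nbr A y x.
Proof. by move=> Asym [->|/Asym]; [left|right]. Qed.

Section Faces.
Local Open Scope fset_scope.
Variables (V : choiceType) (X : complex V).
Implicit Types (u v w x y z : V) (c : seq V).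

Lemma adj_sym x y : adj X x y -> adj X y x.
Proof. by case=> xy f; split; rewrite 1?eq_sym // fsetUC. Qed.

Lemma adj_irr x : ~ adj X x x.
Proof. by case; rewrite eqxx. Qed.

Lemma face2 x y : X [fset x; y] <-> closed_nbr (adj X) x y.
Proof.
split=> [f|[<-|[]//]]; last by rewrite fsetUid; apply: face_vertex.
by have [->|xy] := eqVneq x y; [left|right].
Qed.

Lemma face_nbr s x y : X s -> x \in s -> y \in s -> closed_nbr (adj X) x y.
Proof.
move=> f xs ys; apply/face2; apply: (face_sub f).
  by apply/fsubsetP => z; rewrite !inE => /orP[] /eqP->.
by apply/fset0Pn; exists x; rewrite !inE eqxx.
Qed.

Lemma flag_face s : flag X -> s != fset0 ->
  (forall x y, x \in s -> y \in s -> closed_nbr (adj X) x y) -> X s.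
Proof.
move=> fl s0 cl; apply: fl => // x y xs ys xy.
by have [e|//] := cl _ _ xs ys; move: xy; rewrite e eqxx.
Qed.

(** Positions along the rim turn the cyclic successor into arithmetic, so that
fullness of an explicit cycle becomes a finite check in [full_cycleP]. *)
Lemma index_next c x : uniq c -> x \in c ->
  index (next c x) c = (if (index x c).+1 == size c then 0 else (index x c).+1).
Proof.
move=> uc xc; rewrite next_nth xc; case: c uc xc => // y c uc xc.
have ixc : index x (y :: c) <= size c by rewrite -ltnS -index_mem in xc *.
set i := index x (y :: c) in ixc *; rewrite /= eqSS.
have [ic|ic] := eqVneq i (size c); first by rewrite nth_default ?ic // eqxx.
have ic' : i < size c by rewrite ltn_neqAle ic.
by rewrite -[RHS](index_uniq y (s := y :: c) (i := i.+1)).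
Qed.

Lemma full_cycleP x0 c : 1 < size c -> uniq c ->
  (forall i j, i < j -> j < size c ->
     adj X (nth x0 c i) (nth x0 c j) <->
     (j == i.+1) || (i == 0) && (j.+1 == size c)) ->
  full_cycle X c.
Proof.
move=> c1 uc H; split=> // x y xc yc.
have ne a b : a \in c -> b \in c ->
    (b = next c a <-> index b c = index (next c a) c).
  move=> ac bc; split=> [-> //|/(congr1 (nth x0 c))].
  by rewrite !nth_index ?mem_next.
rewrite !ne // !index_next //.
have ix : index x c < size c by rewrite index_mem.
have iy : index y c < size c by rewrite index_mem.
have Hxy := H (index x c) (index y c); have Hyx := H (index y c) (index x c).
rewrite !nth_index // in Hxy Hyx.
case: (ltngtP (index x c) (index y c)) => [xy|yx|e].
- by rewrite (Hxy xy iy); case: ifP; case: ifP; lia.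
- split=> [/adj_sym/(Hyx yx ix)|yx']; first by case: ifP; case: ifP; lia.
  by apply/adj_sym/(Hyx yx ix); move: yx'; case: ifP; case: ifP; lia.
- have -> : x = y by rewrite -(nth_index x0 xc) e nth_index.
  by split=> [/adj_irr//|]; case: ifP; lia.
Qed.

Lemma next_map_in (W : eqType) (f : V -> W) c x :
  {in c &, injective f} -> uniq c -> x \in c ->
  next (map f c) (f x) = f (next c x).
Proof.
move=> inj uc xc; have ufc : uniq (map f c) by rewrite map_inj_in_uniq.
case/rot_to: (xc) => i c' e.
rewrite -(next_rot i ufc) -(next_rot i uc) -map_rot e.
by case: c' {e} => [|y c'] /=; rewrite !eqxx.
Qed.

End Faces.

Section Dominated.
Local Open Scope fset_scope.
Variables (V : choiceType) (X : complex V).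

Ltac distinct := apply/negP => /eqP ?; subst;
  match goal with
  | H : adj X ?x ?x |- _ => exact: (adj_irr H)
  | H : ~ adj X _ _ |- _ => by apply: H; do ?[exact: adj_sym|assumption]
  | H : ~ closed_nbr (adj X) ?x ?x |- _ => by apply: H; left
  end.

Ltac all_distinct :=
  rewrite /= !inE !negb_or; repeat (apply/andP; split); try done; distinct.

Lemma SD2star_no_4wheel k : SD2star k X -> no_4wheel (adj X).
Proof.
move=> [_ no4 _] o a b c d hub ab bc cd da.
have [ac|ac] := EM (closed_nbr (adj X) a c); first by left.
have [bd|bd] := EM (closed_nbr (adj X) b d); first by right.
case: (no4 o [:: a; b; c; d]) => //; split=> //.
have ac' : ~ adj X a c by move=> ?; apply: ac; right.
have bd' : ~ adj X b d by move=> ?; apply: bd; right.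
apply: (@full_cycleP _ _ a) => //; first by all_distinct.
move=> [|[|[|[|i]]]] [|[|[|[|j]]]] ij jn; try lia; split=> //;
    by move=> _; apply: adj_sym.
Qed.

Lemma pendant_wheel_dominated k o a b c t : SD2star k X ->
  5 <= (size c).+2 < k -> full_cycle X [:: a, b & c] ->
  (forall x, x \in [:: a, b & c] -> adj X o x) ->
  adj X a b -> adj X a t -> adj X b t -> t \notin [:: o, a, b & c] ->
  exists q, forall x, x \in [:: t, o, a, b & c] -> closed_nbr (adj X) q x.
Proof.
move=> [fl _ dom] ck cyc hub ab at_ bt tW.
have [|q qP] := dom _ o a b c t ck erefl.
  split=> //; first by split=> //; case/andP: ck => /ltnW.
  apply: flag_face => //; first by apply/fset0Pn; exists a; rewrite !inE eqxx.
  move=> x y; rewrite !inE -!orbA => /or3P[] /eqP-> /or3P[] /eqP->;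
    first [by left|by right|by right; apply: adj_sym].
exists q => x xW; have : ball1 X q [fset x].
  apply: qP; move: xW; rewrite inE => /orP[/eqP->|xW]; [right|left]; split;
    try exact: face_vertex; move=> y /=; rewrite inE => /eqP-> //=.
  by rewrite !inE eqxx !orbT.
case=> _ /(_ x) /=; rewrite inE eqxx => /(_ isT)[->|]; by [left|right].
Qed.

Lemma SD2star_5wheel k : 5 < k -> SD2star k X -> dominated_5wheels (adj X).
Proof.
move=> k5 sd o a b c d e t hub ab bc cd de ea ac ad bd be ce at_ bt to_.
apply: (pendant_wheel_dominated (c := [:: c; d; e]) sd) => //.
  apply: (@full_cycleP _ _ a) => //; first by all_distinct.
  move=> [|[|[|[|[|i]]]]] [|[|[|[|[|j]]]]] ij jn; try lia; split=> //;
    by move=> _; apply: adj_sym.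
rewrite !inE !negb_or; repeat (apply/andP; split); first exact/eqP.
all: distinct.
Qed.

Lemma SD2star_6wheel k : 6 < k -> SD2star k X -> dominated_6wheels (adj X).
Proof.
move=> k6 sd o a b c d e f t hub ab bc cd de ef fa.
move=> ac ad ae bd be bf ce cf df at_ bt to_.
apply: (pendant_wheel_dominated (c := [:: c; d; e; f]) sd) => //.
  apply: (@full_cycleP _ _ a) => //; first by all_distinct.
  move=> [|[|[|[|[|[|i]]]]]] [|[|[|[|[|[|j]]]]]] ij jn; try lia; split=> //;
    by move=> _; apply: adj_sym.
rewrite !inE !negb_or; repeat (apply/andP; split); first exact/eqP.
all: distinct.
Qed.

End Dominated.

(** * The local condition passes to covers *)

Section Covering.
Local Open Scope fset_scope.
Variables (W V : choiceType) (Y : complex W) (X : complex V) (p : W -> V).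
Hypotheses (X_flag : flag X) (p_cover : covering Y X p).
Notation nbrY := (closed_nbr (adj Y)).
Notation nbrX := (closed_nbr (adj X)).

Lemma cover_inj y a b : nbrY y a -> nbrY y b -> p a = p b -> a = b.
Proof. by case: p_cover => _ _ inj _ /face2 ya /face2 yb; apply: inj ya yb. Qed.

Lemma cover_nbr a b : nbrY a b -> nbrX (p a) (p b).
Proof.
case: p_cover => face _ _ _ /face2/face ab.
by apply: (face_nbr ab); apply: in_imfset; rewrite !inE eqxx ?orbT.
Qed.

Lemma cover_adj a b : adj Y a b -> adj X (p a) (p b).
Proof.
move=> ab; have [e|//] := cover_nbr (or_intror ab : nbrY a b).
by case: (@adj_irr _ Y a); rewrite {2}(@cover_inj a a b) //; [left|right].
Qed.

(** The clause on closed stars only yields some simplex over the image of s;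
injectivity on the star of y shows that it contains s. *)
Lemma cover_lift_face y s : s != fset0 -> (forall a, a \in s -> nbrY y a) ->
  X (p y |` (p @` s)) -> Y s.
Proof.
move=> s0 ys ps; case: p_cover => _ _ _ star.
have : closed_star X (p y) (p @` s).
  split=> //; apply: (face_sub ps); first exact: fsubsetU1.
  by case/fset0Pn: s0 => a a_s; apply/fset0Pn; exists (p a); apply: in_imfset.
rewrite -star => -[s' [fs' ys'] e]; apply: (face_sub fs') => //.
apply/fsubsetP => a a_s.
have : p a \in p @` s' by rewrite e; apply: in_imfset.
case/imfsetP => a' /= a's' e'; rewrite (@cover_inj y a a') //; first exact: ys.
by apply: (face_nbr ys'); rewrite !inE ?eqxx ?a's' ?orbT.
Qed.

(** By flagness the images of a and b span a simplex with the image of y; this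
simplex belongs to the star of that image and lifts. *)
Lemma cover_reflect_nbr y a b : nbrY y a -> nbrY y b -> nbrX (p a) (p b) ->
  nbrY a b.
Proof.
move=> ya yb ab; apply/face2; apply: (@cover_lift_face y).
- by apply/fset0Pn; exists a; rewrite !inE eqxx.
- by move=> c; rewrite !inE => /orP[] /eqP->.
have sy z w : closed_nbr (adj X) z w -> closed_nbr (adj X) w z.
  by apply: closed_nbr_sym; apply: adj_sym.
apply: flag_face => //; first by apply/fset0Pn; exists (p y); rewrite !inE eqxx.
have inE3 c : c \in p y |` (p @` [fset a; b]) -> [\/ c = p y, c = p a | c = p b].
  rewrite !inE => /orP[/eqP->|/imfsetP[d /=]]; first by constructor 1.
  by rewrite !inE => /orP[] /eqP-> ->; [constructor 2|constructor 3].
have pa := cover_nbr ya; have pb := cover_nbr yb.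
by move=> c d /inE3[] -> /inE3[] ->; try exact: sy; try by []; left.
Qed.

Lemma cover_reflect_adj y a b : nbrY y a -> nbrY y b -> adj X (p a) (p b) ->
  adj Y a b.
Proof.
move=> ya yb ab; have [e|//] := cover_reflect_nbr ya yb (or_intror ab).
by case: (@adj_irr _ X (p a)); rewrite {2}e.
Qed.

Lemma cover_lift_nbr y z : nbrX (p y) z -> exists2 a, nbrY y a & p a = z.
Proof.
move=> /face2 yz; case: p_cover => _ _ _ star.
have : closed_star X (p y) [fset z] by split=> //; apply: face_vertex.
rewrite -star => -[s' [fs' ys'] e].
have /fset0Pn[a a_s] := face_neq0 fs'; exists a.
  by apply: (face_nbr ys'); rewrite !inE ?eqxx ?a_s ?orbT.
by apply/eqP; rewrite -in_fset1 -e in_imfset.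
Qed.

Lemma cover_flag : flag Y.
Proof.
move=> s s0 clique; have /fset0Pn[y ys] := s0.
have star a : a \in s -> nbrY y a.
  by move=> a_s; have [->|ya] := eqVneq y a; [left|right; apply: clique].
apply: (cover_lift_face s0 star).
rewrite (_ : _ |` _ = p @` s); last by apply/fsetUidPr; rewrite fsub1set in_imfset.
apply: flag_face => //; first by apply/fset0Pn; exists (p y); rewrite in_imfset.
move=> _ _ /imfsetP[a /= a_s ->] /imfsetP[b /= b_s ->]; apply: cover_nbr.
by have [->|ab] := eqVneq a b; [left|right; apply: clique].
Qed.

Lemma cover_wheel y c : wheel Y y c -> wheel X (p y) (map p c).
Proof.
move=> [c4 [uc cyc] hub].
have star a : a \in c -> nbrY y a by move=> /hub; right.
have inj : {in c &, injective p}.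
  by move=> a b ac bc; apply: cover_inj; apply: star.
split; first by rewrite size_map.
  split; first by rewrite map_inj_in_uniq.
  move=> _ _ /mapP[a ac ->] /mapP[b bc ->].
  rewrite !next_map_in //.
  have nxt x z : x \in c -> z \in c -> p x = p (next c z) <-> x = next c z.
    by move=> xc zc; split=> [/inj|-> //]; apply; rewrite ?mem_next.
  rewrite !nxt // -cyc //; split; first by apply: cover_reflect_adj; apply: star.
  exact: cover_adj.
by move=> _ /mapP[a ac ->]; apply/cover_adj/hub.
Qed.

(** A wheel lies in the star of its hub, so its image is a wheel. The pendant
vertex t lies in the star of v1 instead. The dominating vertex is lifted to the
star of the hub; it is then adjacent or equal to v1, and its adjacency with t is
recovered in the star of v1. *)
Lemma SD2star_cover k : SD2star k X -> SD2star k Y.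
Proof.
move=> [_ no4 dom]; split=> [|y c c4 /cover_wheel|l v0 v1 v2 c t lk cl pw].
- exact: cover_flag.
- by apply: no4; rewrite size_map.
case: pw => [wh tri]; set r := [:: v1, v2 & c] in wh *; rewrite inE negb_or.
move=> /andP[tv0 tr]; have [_ _ hub] := wh.
have inr1 : v1 \in r by rewrite inE eqxx.
have v10 : nbrY v1 v0 by right; apply/adj_sym/hub.
have v1t : nbrY v1 t by apply: (face_nbr tri); rewrite !inE eqxx ?orbT.
have star a : a \in r -> nbrY v0 a by move=> /hub; right.
have [||q qP] := dom l (p v0) (p v1) (p v2) (map p c) (p t) lk.
  by rewrite -cl /= size_map.
  split; first exact: (cover_wheel wh).
    case: p_cover => /(_ _ tri); rewrite !imfsetU !imfset_fset1 //.
  rewrite inE negb_or; apply/andP; split.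
    by apply: contra_neq tv0 => /(cover_inj v1t v10).
  (* A rim vertex a with the same image as t would be adjacent to v1, hence equal
     to t by injectivity on the star of v1. *)
  apply/negP => /(@mapP _ _ p r)[a ar e].
  have v1a : nbrY v1 a.
    apply: (cover_reflect_nbr (star _ inr1) (star _ ar)).
    by rewrite -e; apply: cover_nbr.
  by move: tr; rewrite (cover_inj v1t v1a e) ar.
have near x : x \in [:: p t, p v0 & map p r] -> nbrX q x.
  move=> xW; have : ball1 X q [fset x].
    apply: qP; move: xW; rewrite inE => /orP[/eqP->|xW]; [right|left]; split;
      try exact: face_vertex; move=> z /=; rewrite inE => /eqP-> //=.
    by rewrite !inE eqxx !orbT.
  case=> _ /(_ x) /=; rewrite inE eqxx => /(_ isT)[->|]; by [left|right].
have sy := closed_nbr_sym (@adj_sym _ X).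
have [q' v0q' eq'] : exists2 a, nbrY v0 a & p a = q.
  by apply: cover_lift_nbr; apply/sy/near; rewrite !inE eqxx orbT.
have q'r a : a \in v0 :: r -> nbrY q' a.
  move=> ar; apply: (cover_reflect_nbr v0q'); last rewrite eq'.
    by move: ar; rewrite inE => /orP[/eqP->|/star//]; left.
  by apply: near; rewrite inE (map_f p ar) orbT.
have q't : nbrY q' t.
  apply: (cover_reflect_nbr (y := v1)) => //; last first.
    by rewrite eq'; apply: near; rewrite inE eqxx.
  by apply: (closed_nbr_sym (@adj_sym _ Y)); apply: q'r; rewrite inE inr1 orbT.
have q'W a : a \in [:: t, v0 & r] -> a = q' \/ adj Y q' a.
  rewrite inE => /orP[/eqP->|/q'r]; last by case=> [->|]; by [left|right].
  by case: q't => [->|]; by [left|right].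
exists q' => s [] [fs sub]; split=> // a /sub /= aW; apply: q'W.
  by rewrite inE aW orbT.
by move: aW; rewrite !inE => /or3P[] /eqP->; rewrite eqxx ?orbT.
Qed.

End Covering.

(** * Distance in a connected graph *)

Section GraphDistance.
Variables (T : Type) (A : T -> T -> Prop).
Hypotheses (Asym : forall x y, A x y -> A y x) (Airr : forall x, ~ A x x).
Notation nbr := (closed_nbr A).

(** Steps may be stationary, as in edge paths, so [reach n] is the ball of radius
n. *)
Fixpoint reach n x y : Prop :=
  if n is m.+1 then exists2 z, nbr x z & reach m z y else x = y.

Lemma reach_cat m n x y z : reach m x y -> reach n y z -> reach (m + n) x z.
Proof.
elim: m x => [|m IH] x /=; first by move->.
by move=> [w xw wy] yz; exists w => //; apply: IH.
Qed.

Lemma reach_sym n x y : reach n x y -> reach n y x.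
Proof.
elim: n x => [|n IH] x //= [w xw /IH wy].
rewrite -/(reach n.+1 y x) -addn1; apply: reach_cat wy _.
by exists x => //; apply: closed_nbr_sym.
Qed.

Hypothesis conn : forall x y, exists n, `[< reach n x y >].

Definition gdist x y := ex_minn (conn x y).

Lemma gdist_reach x y : reach (gdist x y) x y.
Proof. by rewrite /gdist; case: ex_minnP => n /asboolP. Qed.

Lemma gdist_min n x y : reach n x y -> gdist x y <= n.
Proof. by rewrite /gdist; case: ex_minnP => m _ min /asboolP/min. Qed.

Lemma gdistxx x : gdist x x = 0.
Proof. by apply/eqP; rewrite -leqn0; apply: gdist_min. Qed.

Lemma gdist_eq0 x y : gdist x y = 0 -> x = y.
Proof. by move=> e; have := gdist_reach x y; rewrite e. Qed.

Lemma gdist_sym x y : gdist x y = gdist y x.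
Proof.
by apply/eqP; rewrite eqn_leq; apply/andP; split;
  apply/gdist_min/reach_sym/gdist_reach.
Qed.

Lemma gdist_triangle y x z : gdist x z <= gdist x y + gdist y z.
Proof. by apply/gdist_min/(reach_cat (y := y)); apply: gdist_reach. Qed.

Lemma gdist_nbr x y : gdist x y <= 1 <-> nbr x y.
Proof.
split=> [|xy]; last by apply: gdist_min; exists y.
case: (gdist x y) (gdist_reach x y) => [|[|]] //=; first by left.
by move=> [z xz <-].
Qed.

Lemma gdist_adj x y : gdist x y = 1 <-> A x y.
Proof.
split=> [e|xy].
  have /gdist_nbr[xy|//] : gdist x y <= 1 by rewrite e.
  by move: e; rewrite xy gdistxx.
apply/eqP; rewrite eqn_leq; apply/andP; split; first by apply/gdist_nbr; right.
by rewrite lt0n; apply/eqP => /gdist_eq0 e; apply: (@Airr x); rewrite {2}e.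
Qed.

Lemma gdist_between k x y : k <= gdist x y ->
  exists2 z, gdist x z = k & gdist z y = gdist x y - k.
Proof.
have H m n : reach (m + n) x y -> exists2 z, reach m x z & reach n z y.
  elim: m (x) => [|m IH] w /=; first by exists w.
  by move=> [u wu /IH[z uz zy]]; exists z => //; exists u.
move=> kd; have := gdist_reach x y; rewrite -{1}(subnKC kd).
move=> /H[z /gdist_min xz /gdist_min zy].
by exists z; have := gdist_triangle z x y; lia.
Qed.

End GraphDistance.

(** * Developing a graph from a vertex *)

Section Development.
Variables (T : eqType) (A : T -> T -> Prop).
Hypotheses (Asym : forall x y, A x y -> A y x) (Airr : forall x, ~ A x x).
Hypotheses (no4 : no_4wheel A) (dom5 : dominated_5wheels A).
Variable v : T.
Implicit Types (s t r : seq T) (x y z : T).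

Notation nbr := (closed_nbr A).
Notation tip := (head v).

(** A word lists the vertices of a path from v, the last one first and v itself
omitted; its tip is its end. The words with [same s s] represent the points of
the developed complex, of which s is in layer [size s], and [same] is equality of
points. A parent is a neighbour in the previous layer, and siblings are neighbours
within a layer. Being free at s is expressed by the stars of the parents of s; it
amounts to lying outside the image of the star of s in the ball built so far
([free_not_low], [cover_step]). The relation E stands for [same] on shorter words. *)
Definition parent_ (E : seq T -> seq T -> Prop) s r := E s (tip s :: r).
Definition sibling_ (E : seq T -> seq T -> Prop) s t :=
  A (tip s) (tip t) /\ exists2 r, parent_ E s r & parent_ E t r.
Definition free_ (E : seq T -> seq T -> Prop) s z :=
  [/\ E s s, A (tip s) z & forall r, parent_ E s r -> ~ nbr (tip r) z].

Fixpoint same_ n s t : Prop :=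
  match n, s, t with
  | 0, [::], [::] => True
  | m.+1, x :: s', y :: t' =>
      [/\ x = y, free_ (same_ m) s' x, free_ (same_ m) t' x
        & same_ m s' t' \/ sibling_ (same_ m) s' t']
  | _, _, _ => False
  end.

Definition same s t := same_ (size s) s t.
Definition parent s r := parent_ same s r.
Definition sibling s t := sibling_ same s t.
Definition free s z := free_ same s z.

Definition near s t := [\/ same s t, sibling s t, parent s t | parent t s].

Lemma same_size_ n s t : same_ n s t -> size s = n /\ size t = n.
Proof.
elim: n s t => [|n IH] [|x s] [|y t] //= [_ [Es _ _] [Et _ _] _].
by have [-> _] := IH _ _ Es; have [-> _] := IH _ _ Et.
Qed.

Lemma same_size s t : same s t -> size t = size s.
Proof. by case/same_size_. Qed.

(** The recursive characterisation, without the explicit bound on lengths. *)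
Lemma same_cons x s y t :
  same (x :: s) (y :: t) <->
  [/\ x = y, free s x, free t x & same s t \/ sibling s t].
Proof.
have parE u r : size u = size s -> parent_ (same_ (size s)) u r = parent u r.
  by move=> <-.
have freeE u z : size u = size s -> free_ (same_ (size s)) u z = free u z.
  by move=> <-.
split=> [[xy Fs Ft st]|[xy Fs Ft st]].
  have ts : size t = size s by case: Ft => /same_size_[].
  rewrite freeE // in Fs; rewrite freeE // in Ft; split=> //.
  case: st => [|[a [r p p']]]; [by left|right].
  by split=> //; exists r; rewrite // -/(parent t r) -parE.
have ts : size t = size s.
  by case: st => [/same_size|[_ [r /same_size <- /same_size <-]]].
split; rewrite ?freeE //.
case: st => [|[a [r p p']]]; [by left|right].
by split=> //; exists r; rewrite // parE.
Qed.

Lemma same_nil t : same [::] t <-> t = [::].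
Proof. by case: t. Qed.

Lemma same_sym s t : same s t -> same t s.
Proof.
have H n a b : size a = n -> same a b -> same b a.
  elim: n a b => [|n IH] [|x a] [|y b] //= [an] /same_cons [<- Fa Fb ab].
  apply/same_cons; split=> //.
  case: ab => [ab|[xy [r ra rb]]]; first by left; exact: IH.
  by right; split; [exact: Asym|exists r].
exact: H.
Qed.

Lemma same_tip s t : same s t -> tip s = tip t.
Proof. by case: s t => [|x s] [|y t] // /same_cons[]. Qed.

Lemma same_refll s t : same s t -> same s s.
Proof.
case: s t => [|x s] [|y t] // /same_cons[_ Fs _ _].
by apply/same_cons; split=> //; left; case: Fs.
Qed.

Lemma same_reflr s t : same s t -> same t t.
Proof. by move=> /same_sym; apply: same_refll. Qed.

Lemma sibling_sym s t : sibling s t -> sibling t s.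
Proof. by move=> [a [r ? ?]]; split; [exact: Asym|exists r]. Qed.

Lemma near_sym s t : near s t -> near t s.
Proof.
by case=> [/same_sym|/sibling_sym||] ?;
  [constructor 1|constructor 2|constructor 4|constructor 3].
Qed.

Lemma parent_size s r : parent s r -> size s = (size r).+1.
Proof. by move=> /same_size. Qed.

Lemma sibling_size s t : sibling s t -> size s = size t.
Proof. by case=> _ [r /parent_size -> /parent_size ->]. Qed.

Lemma parent_free s r : parent s r -> free r (tip s).
Proof. by case: s => [|x s] // /same_cons[]. Qed.

Lemma parent_adj s r : parent s r -> A (tip r) (tip s).
Proof. by move=> /parent_free[]. Qed.

Lemma free_parent s z : free s z -> parent (z :: s) s.
Proof. by move=> F; apply/same_cons; split=> //; left; case: F. Qed.

Lemma near_size s t : near s t -> size s <= (size t).+1 /\ size t <= (size s).+1.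
Proof. by case=> [/same_size|/sibling_size|/parent_size|/parent_size]; lia. Qed.

Lemma near_nbr s t : near s t -> nbr (tip s) (tip t).
Proof.
case=> [/same_tip->|[]|/parent_adj/Asym|/parent_adj]; by [left|right].
Qed.

Lemma near_parent s t : near s t -> size t < size s -> parent s t.
Proof.
by case=> [/same_size|/sibling_size|//|/parent_size]; lia.
Qed.

Lemma near_level s t : near s t -> size t = size s -> same s t \/ sibling s t.
Proof.
by case=> [|||]; [left|right|move/parent_size; lia|move/parent_size; lia].
Qed.

(** What is known of layer n while the development is being built: points of the
layer are well defined; the star of a point of the last layer, as far as it is
built, embeds as a full subgraph; once the next layer is there, the whole star
maps isomorphically. *)
Definition trans_at n := forall s t u, size t = n ->
  same s t -> same t u -> same s u.
Definition local_at n := forall s t u, size s = n -> near s t -> near s u ->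
  size t <= n -> size u <= n ->
  (tip t = tip u -> same t u) /\ (A (tip t) (tip u) -> near t u).
Definition cover_at n := forall s, size s = n -> same s s ->
  (forall z, A (tip s) z -> exists2 t, near s t & tip t = z) /\
  forall t u, near s t -> near s u ->
  (tip t = tip u -> same t u) /\ (A (tip t) (tip u) -> near t u).

Lemma parent_congr_left n s t r :
  trans_at n -> size s = n -> same s t -> parent s r -> parent t r.
Proof.
move=> tr sn st p; rewrite /parent /parent_ -(same_tip st).
by apply: tr p => //; apply: same_sym.
Qed.

Lemma free_congr n s t z :
  trans_at n -> size s = n -> same s t -> free s z -> free t z.
Proof.
move=> tr sn st [_ a F]; split; first exact: same_reflr st.
  by rewrite -(same_tip st).
move=> r p; apply: F; apply: (parent_congr_left tr _ (same_sym st) p).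
by rewrite (same_size st).
Qed.

Lemma parent_congr_right n s r r' :
  trans_at n -> trans_at n.+1 -> size r = n -> same r r' ->
  parent s r -> parent s r'.
Proof.
move=> tr tr1 rn rr p; rewrite /parent /parent_.
have F := parent_free p.
apply: tr1 (p) _ => /=; first by rewrite rn.
apply/same_cons; split=> //; last by left.
exact: (free_congr tr rn rr F).
Qed.

(** The words through two parents represent the same point, and such words are
only identified when the parents are equal or siblings. *)
Lemma parents_near n s r r' : trans_at n -> size s = n ->
  parent s r -> parent s r' -> same r r' \/ sibling r r'.
Proof.
move=> tr sn p p'.
have : same (tip s :: r) (tip s :: r') by apply: tr sn _ p'; exact: same_sym.
by case/same_cons.
Qed.

Lemma near_congr_low n s t u : trans_at n -> size s = n -> same s t ->
  size u <= n -> near s u -> near t u.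
Proof.
move=> tr sn st un; have tn := same_size st; case=> [su|[a [r p p']]|p|p].
- by constructor 1; apply: tr sn _ su; exact: same_sym.
- constructor 2; split; first by rewrite -(same_tip st).
  by exists r => //; apply: (parent_congr_left tr sn st).
- by constructor 3; apply: (parent_congr_left tr sn st).
- by have := parent_size p; lia.
Qed.

Section Step.
Variable n : nat.
Hypothesis trs : forall m, m <= n -> trans_at m.
Hypothesis locs : forall m, m <= n -> local_at m.
Hypothesis covs : forall m, m < n -> cover_at m.

Lemma free_not_low s t z :
  size s = n -> free s z -> near s t -> size t <= n -> tip t <> z.
Proof.
move=> sn [_ a F] st tn tz; case: st => [/same_tip e|[_ [r p p']]|p|/parent_size e].
- by move: a; rewrite e tz; apply: Airr.
- by apply: (F r p); right; rewrite -tz; apply: parent_adj.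
- by apply: (F t p); left.
- lia.
Qed.

(** Otherwise z would be the image of a point of the star of s, which would be
adjacent to s1 since the star of s is embedded, and z would not be free at s1. *)
Lemma free_sibling s s1 z :
  size s = n -> sibling s s1 -> free s1 z -> A (tip s) z -> free s z.
Proof.
move=> sn sib F1 a; have s1n := sibling_size sib.
have ss : same s s by case: sib => _ [r /same_refll].
split=> // r p rz.
have rn := parent_size p.
have [t st [tn tz]] : exists2 t, near s t & size t <= n /\ tip t = z.
  case: rz => [|rz].
    by exists r; [constructor 3|split=> //; lia].
  have rr : same r r by case: (parent_free p).
  have [|sur full] := @covs (size r) _ r erefl rr; first lia.
  have [t rt tz] := sur _ rz.
  exists t; last by split=> //; have := near_size rt; lia.
  have rs : near r s by constructor 4.
  by apply: (full _ _ rs rt).2; rewrite tz.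
have ss1 : near s s1 by constructor 2.
have s1t : near s1 t.
  apply: (locs (leqnn n) sn ss1 st _ tn).2; first lia.
  by rewrite tz; case: F1.
by apply: (free_not_low _ F1 s1t tn tz); lia.
Qed.

Lemma sibling_same_near s t u : size s = n -> sibling s t -> sibling t u ->
  nbr (tip s) (tip u) -> same s u \/ sibling s u.
Proof.
move=> sn st tu; have tn := sibling_size st; have un := sibling_size tu.
have ts : near t s by constructor 2; apply: sibling_sym.
have tu' : near t u by constructor 2.
have [|||eqi adj] := locs (leqnn n) _ ts tu'; try lia.
case=> [/eqi|/adj su]; first by left.
by apply: near_level su _; lia.
Qed.

(** The heart of the construction, and its only use of the domination of 5-wheels.
If the tips of s and u were not adjacent, a common parent of s, t and u would
give a 4-wheel with hub t and rim s, r, u, z. Without a common parent, a parent r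
of s and t and a parent r' of t and u give a 5-wheel with rim s, r, r', u, z, and
a common parent q of r and r' is a pendant vertex. A vertex c dominating all this
lifts to a parent of s, as it is within one step of both q and s, and of z too,
against the freeness of z at s. *)
Lemma free_siblings_trans s t u z : size s = n ->
  free s z -> free t z -> free u z -> sibling s t -> sibling t u ->
  same s u \/ sibling s u.
Proof.
move=> sn Fs Ft Fu st tu; have tn := sibling_size st; have un := sibling_size tu.
have [su|nsu] := EM (nbr (tip s) (tip u)); first exact: sibling_same_near tu su.
exfalso.
have as_ : A (tip s) z by case: Fs.
have at_ : A (tip t) z by case: Ft.
have au : A (tip u) z by case: Fu.
have ast : A (tip s) (tip t) by case: st.
have atu : A (tip t) (tip u) by case: tu.
have no_common r : parent s r -> parent t r -> parent u r -> False.
  move=> ps pt pu.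
  have [] := @no4 (tip t) (tip s) (tip r) (tip u) z.
  - move=> x; rewrite !inE => /or4P[] /eqP-> //; first exact: Asym.
    exact/Asym/parent_adj.
  - exact/Asym/parent_adj.
  - exact: parent_adj.
  - by [].
  - exact: Asym.
  - exact: nsu.
  - by case: Fs => _ _ /(_ r ps).
case: (st) => _ [r ps pt]; case: (tu) => _ [r' pt' pu].
have rn := parent_size ps; have rn' := parent_size pu.
case: (parents_near (trs (leqnn n)) _ pt pt'); first lia.
  move=> rr; apply: (no_common r) => //.
  apply: (@parent_congr_right (size r')) (same_sym rr) pu => //; apply: trs; lia.
move=> rr.
have near_t w : parent t w -> near t w by constructor 3.
have yu : ~ A (tip r) (tip u).
  move=> a; apply: (no_common r) => //.
  have /near_sym ru : near r u.
    apply: (locs (leqnn n) _ (near_t _ pt) _ _ _).2 a; try lia.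
    by constructor 2.
  by apply: near_parent ru _; lia.
have y's : ~ A (tip r') (tip s).
  move=> a; apply: (no_common r') => //.
  have /near_sym ru : near r' s.
    apply: (locs (leqnn n) _ (near_t _ pt') _ _ _).2 a; try lia.
    by constructor 2; apply: sibling_sym.
  by apply: near_parent ru _; lia.
have [yy [q pq pq']] := rr.
have qn := parent_size pq.
have far p w : parent p w -> free p z -> ~ nbr (tip w) z.
  by move=> pw [_ _ /(_ w pw)].
have [c cP] : exists c, forall x, x \in
    [:: tip q; tip t; tip r; tip r'; tip u; z; tip s] -> nbr c x.
  apply: dom5 => //.
  - move=> x; rewrite !inE => /orP[|/or4P[]] /eqP-> //; try exact: Asym.
      exact/Asym/parent_adj.
    exact/Asym/parent_adj.
  - exact: parent_adj.
  - exact: Asym.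
  - exact/Asym/parent_adj.
  - by move=> a; apply: (far _ _ ps Fs); right.
  - by move=> a; apply: (far _ _ pu Fu); right.
  - by move=> a; apply: nsu; right; apply: Asym.
  - exact/Asym/parent_adj.
  - exact/Asym/parent_adj.
  - by move=> e; have [_ _ /(_ q pq)] := parent_free pt; case; left.
have rsame : same r r by case: (parent_free ps).
have [|sur full] := @covs (size r) _ r erefl rsame; first lia.
have nrq : near r q by constructor 3.
have nrs : near r s by constructor 4.
have inN x : x \in [:: tip q; tip t; tip r; tip r'; tip u; z; tip s] -> nbr x c.
  by move=> /cP; apply: closed_nbr_sym.
have [d rd dc] : exists2 d, near r d & tip d = c.
  case: (inN (tip r)); [by rewrite !inE eqxx ?orbT| |exact: sur].
  by move=> e; exists r => //; constructor 1.
have near_d w : near r w -> nbr (tip w) c -> near w d.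
  move=> rw [e|a].
    by constructor 1; apply: (full _ _ rw rd).1; rewrite dc.
  by apply: (full _ _ rw rd).2; rewrite dc.
have qd : near q d by apply: near_d => //; apply: inN; rewrite !inE eqxx.
have sd : near s d by apply: near_d => //; apply: inN; rewrite !inE eqxx ?orbT.
have psd : parent s d.
  by apply: (near_parent sd); have := near_size qd; have := near_size sd; lia.
apply: (far _ _ psd Fs); rewrite dc; apply: cP.
by rewrite !inE eqxx ?orbT.
Qed.

Lemma trans_step : trans_at n.+1.
Proof.
move=> [|x s] [|y t] [|z u] //= [tn] /same_cons[<- Fs Ft st] /same_cons[<- _ Fu tu].
apply/same_cons; split=> //.
have trn := trs (leqnn n).
case: st tu => [st|st] [tu|tu].
- by left; apply: trn tu.
- right; case: tu => [a [r p p']]; split; first by rewrite (same_tip st).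
  by exists r => //; apply: (parent_congr_left trn tn (same_sym st) p).
- right; case: st => [a [r p p']]; split; first by rewrite -(same_tip tu).
  by exists r => //; apply: (parent_congr_left trn tn tu).
- by apply: (free_siblings_trans _ Fs Ft Fu st tu); rewrite (sibling_size st).
Qed.

(** A neighbour of the tip of s is either free at s, and then is the tip of a new
point, or lies under the star of a parent. *)
Lemma cover_step : cover_at n.
Proof.
move=> s sn ss; split=> [z sz|t u st su].
  have [F|nF] := EM (free s z).
    by exists (z :: s) => //; constructor 4; apply: free_parent.
  have [[r p rz]|no] := EM (exists2 r, parent s r & nbr (tip r) z); last first.
    by case: nF; split=> // r p rz; apply: no; exists r.
  have rn := parent_size p.
  case: rz => [rz|rz]; first by exists r => //; constructor 3.
  have rr : same r r by case: (parent_free p).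
  have [|sur full] := @covs (size r) _ r erefl rr; first lia.
  have [t rt tz] := sur _ rz; exists t => //.
  have rs : near r s by constructor 4.
  by apply: (full _ _ rs rt).2; rewrite tz.
have dich w : near s w -> size w <= n \/ parent w s.
  by case=> [/same_size|/sibling_size|/parent_size|]; [left; lia..|right].
(* A point of the new layer against a point of the old ball. *)
have child_low a b : parent a s -> near s b -> size b <= n ->
    tip a <> tip b /\ (A (tip a) (tip b) -> parent a b).
  move=> p sb bn; have F := parent_free p; split.
    by move=> e; apply: (free_not_low sn F sb bn).
  have E' b' : same s b' \/ sibling s b' -> A (tip b') (tip a) -> parent a b'.
    move=> sb' ab; rewrite /parent /parent_.
    have F' : free b' (tip a).
      case: sb' => [e|e]; first exact: (free_congr (trs (leqnn n)) sn e F).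
      by apply: free_sibling (sibling_sym e) F ab; rewrite -(sibling_size e).
    by apply: trans_step (p) _ => /=; rewrite ?sn //; apply/same_cons.
  move=> /Asym ab; case: sb => [e|e|e|/parent_size e].
  - by apply: E' => //; left.
  - by apply: E' => //; right.
  - by have [_ _ /(_ b e)] := F; case; right.
  - lia.
case: (dich _ st) (dich _ su) => [tn|tp] [un|up].
- exact: (locs (leqnn n) sn st su tn un).
- have [ne adj] := child_low _ _ up st tn; split; first by move=> e; case: ne.
  by move=> /Asym/adj; constructor 4.
- have [ne adj] := child_low _ _ tp su un; split=> //.
  by move=> /adj; constructor 3.
- split=> [e|a]; last by constructor 2; split=> //; exists s.
  apply: (trans_step _ tp); first by rewrite /= sn.
  by rewrite e; apply: same_sym.
Qed.

(** If s is not yet the common parent of q and t, it is adjacent to that parent, and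
the tip of t, free there, is also free at s by [free_sibling]. *)
Lemma parent_vs_sibling q s t : size q = n.+1 -> parent q s -> sibling q t ->
  tip s <> tip t /\ (A (tip s) (tip t) -> parent t s).
Proof.
move=> qn ps [qt [s1 ps1 pt]].
have sn := parent_size ps; have sn1 := parent_size ps1.
have F := parent_free pt.
have := parents_near trans_step qn ps ps1.
case=> [e|sib]; split.
- by move=> st; have [_ a _] := F; move: a; rewrite -(same_tip e) st; apply: Airr.
- by move=> _; apply: (parent_congr_right (trs (leqnn n)) trans_step _ (same_sym e) pt);
    lia.
- move=> st; apply: (free_not_low _ F _ _ st); try lia.
  by constructor 2; apply: sibling_sym.
- move=> a; have F' : free s (tip t) by apply: free_sibling sib F a; lia.
  apply: trans_step (pt) _ => /=; first by lia.
  by apply/same_cons; split=> //; right; apply: sibling_sym.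
Qed.

(** Unless t and u share a parent, two parents of q and the points t, u would form
a 4-wheel around q. *)
Lemma siblings_near q t u : size q = n.+1 -> sibling q t -> sibling q u ->
  (tip t = tip u -> same t u) /\ (A (tip t) (tip u) -> sibling t u).
Proof.
move=> qn qt qu; case: (qt) (qu) => [at_ [s ps pt]] [au [s' ps' pu]].
have sn := parent_size ps; have sn' := parent_size ps'.
have tr1 := trans_step.
have tn := sibling_size qt; have un := sibling_size qu.
have Ft := parent_free pt; have Fu := parent_free pu.
have := parents_near tr1 qn ps ps'; case=> [e|sib]; split.
- move=> tu; apply: (tr1 _ (tip t :: s)) => //=; first by lia.
  apply: (tr1 _ (tip u :: s')) => //=; [by lia| |exact: same_sym].
  by apply/same_cons; split=> //; [rewrite tu; exact: Fu|left].
- move=> a; split=> //; exists s => //.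
  by apply: (parent_congr_right (trs (leqnn n)) tr1 _ (same_sym e) pu); lia.
- move=> tu; apply: (tr1 _ (tip t :: s)) => //=; first by lia.
  apply: (tr1 _ (tip u :: s')) => //=; [by lia| |exact: same_sym].
  by apply/same_cons; split=> //; [rewrite tu; exact: Fu|right].
- move=> a.
  have [ne1 adj1] := parent_vs_sibling qn ps' qt.
  have [ne2 adj2] := parent_vs_sibling qn ps qu.
  have [/adj1 p|na1] := EM (A (tip s') (tip t)); first by split=> //; exists s'.
  have [/adj2 p|na2] := EM (A (tip s) (tip u)); first by split=> //; exists s.
  case: (@no4 (tip q) (tip s) (tip s') (tip u) (tip t)).
  + move=> x; rewrite !inE => /or4P[] /eqP-> //; exact/Asym/parent_adj.
  + by case: sib.
  + exact: parent_adj.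
  + exact: Asym.
  + exact/Asym/parent_adj.
  + by case.
  + by case.
Qed.

Lemma local_step : local_at n.+1.
Proof.
move=> q t u qn qt qu tn un.
have low w : near q w -> size w <= n.+1 -> [\/ same q w, sibling q w | parent q w].
  move=> qw wn; case: qw => [?|?|?|/parent_size];
    [exact: Or31|exact: Or32|exact: Or33|lia].
have irr x y : x = y -> ~ A x y by move=> ->; apply: Airr.
case: (low _ qt tn) (low _ qu un) => [e|e|e] qu'.
- split; last by move=> _; apply: near_congr_low trans_step qn e un qu.
  rewrite -(same_tip e); case: qu' => [f _|[a _] /irr//|/parent_adj/Asym a /irr//].
  by apply: trans_step f => //; exact: same_sym.
- case: qu' => [f|f|f].
  + split; last by move=> _; apply/near_sym/(near_congr_low trans_step qn f tn qt).
    by case: e => [a _] eq; move: a; rewrite (same_tip f) eq => /Airr.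
  + have [eqi adj] := siblings_near qn e f; split=> //.
    by move=> /adj; constructor 2.
  + have [ne adj] := parent_vs_sibling qn f e; split; first by move=> /esym.
    by move=> /Asym/adj; constructor 3.
- case: qu' => [f|f|f].
  + split; last by move=> _; apply/near_sym/(near_congr_low trans_step qn f tn qt).
    by have /irr a := parent_adj e; rewrite -(same_tip f) => /a.
  + have [ne adj] := parent_vs_sibling qn e f; split=> //.
    by move=> /adj; constructor 4.
  + have := parents_near trans_step qn e f; case=> h; split=> //.
    * by constructor 1.
    * by case: h => [a _] eq; move: a; rewrite eq => /Airr.
    * by constructor 2.
Qed.

End Step.

Lemma development n : [/\ forall m, m <= n -> trans_at m,
  forall m, m <= n -> local_at m & forall m, m < n -> cover_at m].
Proof.
elim: n => [|n [tr lo co]].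
  split=> // m; rewrite leqn0 => /eqP-> s t u.
    by move=> /size0nil-> /same_sym/same_nil->.
  move=> /size0nil-> _ _; rewrite !leqn0 => /nilP-> /nilP->; split=> //.
  by move=> /Airr.
have ltS m : m <= n.+1 -> m <= n \/ m = n.+1 by lia.
split=> m.
- by case/ltS => [/tr//|->]; apply: trans_step.
- by case/ltS => [/lo//|->]; apply: local_step.
- by rewrite ltnS leq_eqVlt => /predU1P[->|/co//]; apply: cover_step.
Qed.

Lemma same_trans s t u : same s t -> same t u -> same s u.
Proof. by have [/(_ _ (leqnn _)) + _ _] := development (size t); apply. Qed.

Lemma lift_nbr s z : same s s -> A (tip s) z -> exists2 t, near s t & tip t = z.
Proof.
by move=> ss; have [_ _ /(_ _ (leqnn _)) /(_ s erefl ss)[+ _]] :=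
  development (size s).+1; apply.
Qed.

Lemma near_full s t u : near s t -> near s u ->
  (tip t = tip u -> same t u) /\ (A (tip t) (tip u) -> near t u).
Proof.
move=> st; have ss : same s s.
  by case: st => [/same_refll|[_ [r /same_refll]]|/same_refll|/parent_free[]].
by have [_ _ /(_ _ (leqnn _)) /(_ s erefl ss)[_ +]] :=
  development (size s).+1; apply.
Qed.

Lemma near_nbr_full s t u :
  near s t -> near s u -> nbr (tip t) (tip u) -> near t u.
Proof.
move=> st su; have [eqi adj] := near_full st su.
by case=> [/eqi|/adj//]; constructor 1.
Qed.

Lemma near_same s t : near s t -> same t t.
Proof.
case=> [/same_reflr //|[_ [r _ /same_refll //]]|/parent_free F|/same_refll //].
by case: F.
Qed.

Lemma near_refl s : same s s -> near s s.
Proof. by constructor 1. Qed.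

Lemma near_congr s t u : same s t -> near s u -> near t u.
Proof.
move=> st su; have st' : near s t by constructor 1.
by apply: (near_nbr_full st' su); rewrite -(same_tip st); apply: near_nbr.
Qed.

(** [lifts s p t]: a lift of the path p that starts near s ends at t. The first
vertex of p is also a step, possibly stationary. *)
Fixpoint lifts s (p : seq T) t : Prop :=
  if p is x :: q then exists s', [/\ near s s', tip s' = x & lifts s' q t]
  else same s t.

Lemma lifts_congr s s' p t : same s s' -> lifts s p t -> lifts s' p t.
Proof.
case: p => [ss|x p ss [u [su ux up]]]; last first.
  by exists u; split=> //; apply: near_congr su.
by apply: same_trans; apply: same_sym.
Qed.

Lemma lifts_catl p q q' s t :
  (forall s, lifts s q t -> lifts s q' t) ->
  lifts s (p ++ q) t -> lifts s (p ++ q') t.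
Proof.
move=> qq'; elim: p s => [|x p IH] s /=; first exact: qq'.
by move=> [u [su ux /IH up]]; exists u.
Qed.

Lemma lifts_stutter s x q t : lifts s [:: x, x & q] t <-> lifts s (x :: q) t.
Proof.
split=> [[u [su ux [w [uw wx wq]]]]|[u [su ux uq]]].
  exists u; split=> //; apply: lifts_congr wq; apply: same_sym.
  have uu : near u u by apply/near_refl/(near_same su).
  by apply: (near_full uu uw).1; rewrite ux wx.
exists u; split=> //; exists u; split=> //; exact/near_refl/(near_same su).
Qed.

(** Stars embed as full subgraphs: three successive points over a triangle are
pairwise adjacent. *)
Lemma lifts_triangle s x y z q t : nbr x y -> nbr x z -> nbr y z ->
  lifts s [:: x, y, z & q] t <-> lifts s [:: x, z & q] t.
Proof.
move=> xy xz yz; split=> [[a [sa ax [b [ab by_ [c [bc cz cq]]]]]]|].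
  exists a; split=> //; exists c; split=> //.
  by apply: (near_nbr_full (near_sym ab) bc); rewrite ax cz.
move=> [a [sa ax [c [ac cz cq]]]]; have aa := near_same sa.
have [b ab by_] : exists2 b, near a b & tip b = y.
  case: xy => [<-|xy]; first by exists a => //; apply: near_refl.
  by apply: lift_nbr => //; rewrite ax.
exists a; split=> //; exists b; split=> //; exists c; split=> //.
by apply: (near_nbr_full ab ac); rewrite by_ cz.
Qed.

(** A word is itself the way back to v, along its successive parents. *)
Lemma lifts_down s' s q t : near s' s -> lifts [::] q t ->
  lifts s' (rcons s v ++ q) t.
Proof.
elim: s s' => [|x s IH] s' ss' qt /=; first by exists [::].
exists (x :: s); split=> //; apply: IH => //; constructor 3.
by have /free_parent := parent_free (near_same ss' : parent (x :: s) s).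
Qed.

Lemma lifts_up s q t : same s s -> lifts s q t -> lifts [::] (rev s ++ q) t.
Proof.
elim: s q => [|x s IH] q //= ss qt.
have p : parent (x :: s) s by [].
rewrite rev_cons cat_rcons; apply: IH; first by case: (parent_free p).
by exists (x :: s); split=> //; constructor 4.
Qed.

Lemma lifts_last s p t : lifts s p t -> last (tip s) p = tip t.
Proof.
elim: p s => [|x p IH] s /=; first exact: same_tip.
by move=> [u [_ <- /IH]].
Qed.

Lemma lifts_same s p t : lifts s p t -> same t t.
Proof.
by elim: p s => [|x p IH] s /=; [apply: same_reflr|move=> [u [_ _ /IH]]].
Qed.

Section Bijective.
Hypothesis tip_inj : forall s t, same s s -> same t t -> tip s = tip t -> same s t.
Hypothesis tip_surj : forall x, exists2 s, same s s & tip s = x.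
Hypothesis conn : forall x y, exists n, `[< reach A n x y >].
Notation d := (gdist conn).

(** A step changes the layer by at most one, and every point is one step away from
its parents. *)
Lemma gdist_tip s : same s s -> d v (tip s) = size s.
Proof.
move=> ss; apply/eqP; rewrite eqn_leq; apply/andP; split.
  apply: gdist_min; elim: s ss => [|x s IH] //= p.
  rewrite -/(reach A (size s).+1 v x) -addn1; apply: (@reach_cat _ _ _ _ _ (tip s)).
    by apply: IH; case: (parent_free (p : parent (x :: s) s)).
  by exists x => //; right; apply: (parent_adj (p : parent (x :: s) s)).
have up n r y : same r r -> reach A n (tip r) y ->
    exists t, [/\ same t t, tip t = y & size t <= size r + n].
  elim: n r => [|n IH] r rr /=; first by move=> <-; exists r; split=> //; lia.
  move=> [z rz zy].
  have [r' rr' r'z] : exists2 r', near r r' & tip r' = z.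
    case: rz => [<-|]; first by exists r => //; apply: near_refl.
    exact: lift_nbr.
  rewrite -r'z in zy.
  have [t [tt ty tn]] := IH _ (near_same rr') zy.
  by exists t; split=> //; have := near_size rr'; lia.
have [t [tt ts tn]] := up _ [::] _ I (gdist_reach conn v (tip s)).
by rewrite (same_size (tip_inj tt ss ts)); move: tn; rewrite add0n.
Qed.

Lemma near_tips s t : same s s -> same t t -> nbr (tip s) (tip t) -> near s t.
Proof.
move=> ss tt [e|a]; first by constructor 1; apply: tip_inj.
have [u su ut] := lift_nbr ss a.
by apply/near_sym/(near_congr _ (near_sym su))/tip_inj => //; apply: near_same su.
Qed.

Lemma triangle_condition n x y : d v x = n.+1 -> d v y = n.+1 -> A x y ->
  exists z, [/\ d v z = n, A z x & A z y].
Proof.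
have [s ss <-] := tip_surj x; have [t tt <-] := tip_surj y.
rewrite !gdist_tip // => sn tn st.
have /near_level : near s t by apply: near_tips => //; right.
rewrite sn tn => /(_ erefl)[/same_tip e|[_ [r p p']]].
  by move: st; rewrite e => /Airr.
exists (tip r); split; try exact: parent_adj.
rewrite gdist_tip; first by have := parent_size p; lia.
by case: (parent_free p).
Qed.

Lemma clique_condition n x y z : d v z = n.+1 -> d v x = n -> d v y = n ->
  A z x -> A z y -> nbr x y.
Proof.
have [s ss <-] := tip_surj x; have [t tt <-] := tip_surj y.
have [u uu <-] := tip_surj z.
rewrite !gdist_tip // => un sn tn us ut.
have pus : parent u s.
  by apply: near_parent; [apply: near_tips => //; right|lia].
have put : parent u t.
  by apply: near_parent; [apply: near_tips => //; right|lia].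
have tr m : trans_at m by move=> a b c _; apply: same_trans.
case: (parents_near (tr _) un pus put) => [/same_tip|[]]; by [left|right].
Qed.

End Bijective.

End Development.

(** * Thin intervals and triangles *)

Section WeaklySystolic.
Variables (T : eqType) (A : T -> T -> Prop).
Hypotheses (Asym : forall x y, A x y -> A y x) (Airr : forall x, ~ A x x).
Hypothesis conn : forall x y, exists n, `[< reach A n x y >].
Notation d := (gdist conn).
Notation nbr := (closed_nbr A).
Hypothesis triangle_cond : forall u n x y, d u x = n.+1 -> d u y = n.+1 ->
  A x y -> exists z, [/\ d u z = n, A z x & A z y].
Hypothesis clique_cond : forall u n x y z, d u z = n.+1 -> d u x = n ->
  d u y = n -> A z x -> A z y -> nbr x y.

(** y lies on a geodesic from x to z. *)
Definition btw x y z := d x y + d y z = d x z.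

Let dC x y : d x y = d y x. Proof. exact: gdist_sym. Qed.
Let dT y x z : d x z <= d x y + d y z. Proof. exact: gdist_triangle. Qed.
Let d0 x y : d x y = 0 -> x = y. Proof. exact: gdist_eq0. Qed.
Let dA x y : A x y -> d x y = 1. Proof. by move=> /(gdist_adj Airr conn). Qed.
Let d1A x y : d x y = 1 -> A x y. Proof. by move=> /(gdist_adj Airr conn). Qed.
Let dN x y : nbr x y -> d x y <= 1. Proof. by move=> /(gdist_nbr conn). Qed.

Lemma btw_sym x y z : btw x y z -> btw z y x.
Proof. by rewrite /btw (dC x y) (dC y z) (dC x z) addnC. Qed.

Lemma btw_transl x y z w : btw x y z -> btw x w y -> btw x w z.
Proof. by rewrite /btw; have := dT y w z; have := dT w x z; lia. Qed.

Lemma btw_transr x y z w : btw x y z -> btw y w z -> btw x w z.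
Proof. by rewrite /btw; have := dT y x w; have := dT w x z; lia. Qed.

(** On a plateau the triangle condition moves a geodesic from v to y one level down.
A rise would have to be followed by a descent, and then the clique condition at
the top gives a shortcut. *)
Lemma descend u v y : d u y < d u v ->
  exists x, [/\ A v x, (d x y).+1 = d v y & (d u x).+1 = d u v].
Proof.
have [m] := ubnP (d v y); elim: m v => // m IH v vym uyv.
have [v1 vv1 v1y] : exists2 z, d v z = 1 & d z y = d v y - 1.
  apply: gdist_between; rewrite lt0n; apply/eqP => /d0 e.
  by move: uyv; rewrite e ltnn.
have := dT v1 u v; have := dT v u v1; rewrite (dC v1 v) vv1 => l1 l2.
have vy0 : 0 < d v y.
  rewrite lt0n; apply/eqP => /d0 e; by move: uyv; rewrite e ltnn.
have a1 : A v v1 by apply: d1A.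
have [low|] := leqP (d u v) (d u v1); last by exists v1; split=> //; lia.
have [x1 [a x1y ux1]] : exists x,
    [/\ A v1 x, (d x y).+1 = d v1 y & (d u x).+1 = d u v1].
  by apply: IH; lia.
have [eq|lt] := eqVneq (d u v1) (d u v); last first.
  have /dN : nbr v x1.
    by apply: (clique_cond (u := u) (n := d u v) _ _ _ (Asym a1) a); lia.
  by have := dT x1 v y; lia.
case E : (d u v) => [|n]; first by lia.
have [x0 [ux0 x0v x0v1]] := @triangle_cond u n v v1 E (etrans eq E) a1.
exists x0; split; [exact: Asym| |lia].
have /dN : nbr x0 x1.
  by apply: (clique_cond (u := u) (n := n) _ _ _ (Asym x0v1) a); lia.
have := dT x1 x0 y; have := dT x0 v y; rewrite (dC v x0) (dA x0v); lia.
Qed.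

(** At a vertex of maximal level, [descend] towards both ends gives two closer
neighbours; they are adjacent or equal, which is a shortcut. *)
Lemma ball_convex u v y w : btw v y w -> d u y <= maxn (d u v) (d u w).
Proof.
move=> b; rewrite leqNgt; apply/negP; rewrite gtn_max => /andP[uv uw].
have [x [yx xv ux]] := descend uv; have [x' [yx' x'w ux']] := descend uw.
have /dN : nbr x x' by apply: (clique_cond (u := u) (n := d u x) _ _ _ yx yx'); lia.
have := dT x v w; have := dT x' x w.
by move: b; rewrite /btw (dC v x) (dC v y); lia.
Qed.

(** The part of the rim around b that lies one level closer to u has one vertex or
two. *)
Lemma lower_link u k a b c : d u a = k.+1 -> d u b = k.+1 -> d u c = k.+1 ->
  A a b -> A b c ->
  (exists x, [/\ d u x = k, A x a, A x b & A x c]) \/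
  exists x y, [/\ d u x = k, d u y = k &
     [/\ A x a, A x b, A y b & A y c] /\ [/\ A x y, ~ A x c & ~ A y a]].
Proof.
move=> ua ub uc ab bc.
have [x [ux xa xb]] := triangle_cond ua ub ab.
have [y [uy yb yc]] := triangle_cond ub uc bc.
have [xc|xc] := EM (A x c); first by left; exists x.
have [ya|ya] := EM (A y a); first by left; exists y.
right; exists x, y; split=> //; split=> //.
case: (clique_cond ub ux uy (Asym xb) (Asym yb)) => [e|]; last by split.
by case: xc; rewrite e.
Qed.

Hypotheses (no4 : no_4wheel A) (dom5 : dominated_5wheels A).
Hypothesis dom6 : dominated_6wheels A.

(** The path a, b, c lies in a level of the interval from u to v. If the link of b
on the side of v needs two vertices, these carry a pendant triangle one level
further. *)
Section Thin.
Variables (u v a b c : T) (k m : nat).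
Hypotheses (ab : A a b) (bc : A b c) (ac : ~ nbr a c).

Lemma no_double_link :
  d u v = k + m + 2 ->
  d u a = k.+1 -> d u b = k.+1 -> d u c = k.+1 ->
  d v a = m.+1 -> d v b = m.+1 -> d v c = m.+1 ->
  forall x y, d v x = m -> d v y = m -> A x a -> A x b -> A y b -> A y c ->
  A x y -> ~ A x c -> ~ A y a -> False.
Proof.
move=> uv ua ub uc va vb vc x y vx vy xa xb yb yc xy xc ya.
have [m' Em] : exists m', m = m'.+1.
  case: m vx vy => [|m'] vx vy; last by exists m'.
  by case: (@Airr x); rewrite {2}(_ : x = y) // -(d0 vx) -(d0 vy).
rewrite Em in vx vy.
have [t [vt tx ty]] := triangle_cond vx vy xy.
have tb : t <> b by move=> e; move: vt; rewrite e; lia.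
have up z z' : d u z = k -> d v z' = m -> ~ A z z'.
  move=> uz vz' /dA; have := dT z u v; have := dT z' z v.
  by rewrite (dC z' v); lia.
(* A vertex dominating the pendant triangle and the lower link is a shortcut. *)
have short z q : d u z = k -> nbr q z -> nbr q t -> False.
  move=> uz /dN qz /dN qt; have := dT z u v; have := dT q z v; have := dT t q v.
  by rewrite (dC z q) (dC t v); lia.
have ac' : ~ A a c by move=> ?; apply: ac; right.
have ca' : ~ A c a by move/Asym.
case: (lower_link ua ub uc ab bc) => [[z [uz za zb zc]]|].
  have [q qP] : exists q, forall w, w \in [:: t; b; y; x; a; z; c] -> nbr q w.
    apply: dom5 => //; try exact: Asym.
    - move=> w; rewrite !inE => /orP[|/or4P[]] /eqP-> //; exact: Asym.
    - by move=> /Asym; apply: up; lia.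
    - by move=> /Asym; apply: up; lia.
  by apply: (short z q) => //; apply: qP; rewrite !inE eqxx ?orbT.
move=> [z [z' [uz uz' [[za zb z'b z'c] [zz' zc z'a]]]]].
have [q qP] : exists q, forall w, w \in [:: t; b; y; x; a; z; z'; c] -> nbr q w.
  apply: dom6 => //; try exact: Asym.
  - move=> w; rewrite !inE => /orP[|/orP[|/or4P[]]] /eqP-> //; exact: Asym.
  - by move=> /Asym; apply: up; lia.
  - by move=> /Asym; apply: up; lia.
  - by move=> /Asym; apply: up; lia.
  - by move=> /Asym; apply: up; lia.
  - by move=> /Asym.
by apply: (short z q) => //; apply: qP; rewrite !inE eqxx ?orbT.
Qed.
End Thin.

Lemma interval_thin u v x y : btw u x v -> btw u y v -> d u x = d u y -> d x y <= 1.
Proof.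
move=> bx by_ xy; rewrite leqNgt; apply/negP => xy2.
have [b xb by1] : exists2 z, d x z = 1 & d z y = d x y - 1.
  by apply: gdist_between; lia.
have [c bc cy] : exists2 z, d b z = 1 & d z y = d b y - 1.
  by apply: gdist_between; lia.
have xc : d x c = 2 by have := dT b x c; have := dT c x y; lia.
have bb : btw x b y by rewrite /btw; lia.
have bc' : btw x c y by rewrite /btw; lia.
move: (bx) (by_); rewrite /btw => bx' by'.
have [ub vb] : d u b = d u x /\ d v b = d v x.
  have := ball_convex u bb; have := ball_convex v bb; rewrite -xy maxnn.
  have -> : d v y = d v x by rewrite (dC v y) (dC v x); lia.
  by rewrite maxnn; have := dT b u v; rewrite (dC b v) (dC v x); lia.
have [uc vc] : d u c = d u x /\ d v c = d v x.
  have := ball_convex u bc'; have := ball_convex v bc'; rewrite -xy maxnn.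
  have -> : d v y = d v x by rewrite (dC v y) (dC v x); lia.
  by rewrite maxnn; have := dT c u v; rewrite (dC c v) (dC v x); lia.
have ax := d1A xb; have ac := d1A bc.
have nxc : ~ nbr x c by move=> /dN; lia.
have pos w : d w b = d w x -> exists k, d w x = k.+1.
  case E : (d w x) => [|k] wb; last by exists k.
  by case: (@Airr x); rewrite {2}(_ : x = b) // -(d0 E) -(d0 wb).
have [k uk] := pos _ ub; have [m vm] := pos _ vb.
have uv : d u v = k + m + 2 by rewrite (dC x v) in bx'; lia.
rewrite uk in ub uc; rewrite vm in vb vc.
case: (lower_link vm vb vc ax ac) => [[z [vz zx zb zc]]|]; last first.
  move=> [z [z' [vz vz' [[zx zb z'b z'c] [zz' nzc nz'x]]]]].
  exact: (no_double_link ax ac nxc uv uk ub uc vm vb vc vz vz' zx zb z'b z'c).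
case: (lower_link uk ub uc ax ac) => [[w [uw wx wb wc]]|]; last first.
  move=> [w [w' [uw uw' [[wx wb w'b w'c] [ww' nwc nw'x]]]]].
  apply: (no_double_link ax ac nxc _ vm vb vc uk ub uc uw uw' wx wb w'b w'c) => //.
  by rewrite dC; lia.
case: (@no4 b x z c w) => //; try exact: Asym.
  by move=> t; rewrite !inE => /or4P[] /eqP-> //; exact: Asym.
move=> /dN; have := dT w u v; have := dT z w v; rewrite (dC z v) (dC z w); lia.
Qed.

(** The first three edges of the side from v to w, seen from u, carry a row x0, x1,
x2 one level down and a row z0, z1 two levels down. If z0 and z1 can be chosen
equal, x1 is the hub of a 5-wheel and v is pendant: a dominating vertex would
be on a geodesic from v to w but too close to u. Otherwise x1 is the hub of a
6-wheel with a pendant vertex t three levels down, too far from y1. *)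
Lemma flat_side_small u v w k :
  (forall y, btw v y w -> d u y = k) -> 3 <= d v w -> k <= 2.
Proof.
move=> flat vw; rewrite leqNgt; apply/negP => k3.
(* No vertex off level k is on a geodesic between two vertices of the side. *)
have off z i j yi yj : d v yi = i -> d v yj = j -> btw v yi w -> btw v yj w ->
    i <= j -> d u z <> k -> j - i < d yi z + d z yj.
  rewrite /btw => vi vj bi bj ij uz; rewrite ltnNge; apply/negP => le.
  apply: uz; apply: flat; rewrite /btw.
  by have := dT yi v z; have := dT yj z w; have := dT z v w; lia.
have [y1 v1 y1w] : exists2 z, d v z = 1 & d z w = d v w - 1.
  by apply: gdist_between; lia.
have [y2 y12 y2w] : exists2 z, d y1 z = 1 & d z w = d y1 w - 1.
  by apply: gdist_between; lia.
have [y3 y23 y3w] : exists2 z, d y2 z = 1 & d z w = d y2 w - 1.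
  by apply: gdist_between; lia.
have v2 : d v y2 = 2 by have := dT y1 v y2; have := dT y2 v w; lia.
have v3 : d v y3 = 3 by have := dT y2 v y3; have := dT y3 v w; lia.
have b0 : btw v v w by rewrite /btw gdistxx.
have b1 : btw v y1 w by rewrite /btw; lia.
have b2 : btw v y2 w by rewrite /btw; lia.
have b3 : btw v y3 w by rewrite /btw; lia.
have v0 : d v v = 0 by rewrite gdistxx.
have [k' Ek] : exists k', k = k'.+3 by exists (k - 3); lia.
have a01 := d1A v1; have a12 := d1A y12; have a23 := d1A y23.
have u0 := flat _ b0; have u1 := flat _ b1.
have u2 := flat _ b2; have u3 := flat _ b3.
rewrite Ek in u0 u1 u2 u3.
have [x0 [ux0 x00 x01]] := triangle_cond u0 u1 a01.
have [x1 [ux1 x11 x12]] := triangle_cond u1 u2 a12.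
have [x2 [ux2 x22 x23]] := triangle_cond u2 u3 a23.
have n02 : ~ A x0 y2.
  by move=> /dA a; have := off x0 _ _ _ _ v0 v2 b0 b2 isT;
    rewrite (dC v x0) (dA x00); lia.
have n13 : ~ A x1 y3.
  by move=> /dA a; have := off x1 _ _ _ _ v1 v3 b1 b3 isT;
    rewrite (dC y1 x1) (dA x11); lia.
have n21 : ~ A x2 y1.
  by move=> /dA a; have := off x2 _ _ _ _ v1 v3 b1 b3 isT;
    rewrite (dC y1 x2) (dA x23); lia.
have nx02 : ~ nbr x0 x2.
  move=> /dN a; have := off x0 _ _ _ _ v0 v3 b0 b3 isT; have := dT x2 x0 y3.
  by rewrite (dC v x0) (dA x00) (dA x23); lia.
have x0x1 : A x0 x1.
  case: (clique_cond u1 ux0 ux1 (Asym x01) (Asym x11)) => // e.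
  by case: n02; rewrite e.
have x1x2 : A x1 x2.
  case: (clique_cond u2 ux1 ux2 (Asym x12) (Asym x22)) => // e.
  by case: n13; rewrite e.
have low z y : d u z = k'.+1 -> d u y = k'.+3 -> ~ A z y.
  by move=> uz uy /dA; have := dT z u y; lia.
have low' z y : d u z = k'.+1 -> d u y = k'.+3 -> ~ A y z.
  by move=> uz uy /Asym; apply: low.
have nx02' : ~ A x0 x2 by move=> ?; apply: nx02; right.
have nx20' : ~ A x2 x0 by move/Asym.
have single z : d u z = k'.+1 -> A z x0 -> A z x1 -> A z x2 -> False.
  move=> uz z0 z1 z2.
  have [q qP] : exists q, forall t, t \in [:: v; x1; x0; y1; y2; x2; z] -> nbr q t.
    apply: dom5 => //; try exact: Asym;
      try (exact: low); try (exact: low'); try by move/Asym.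
    - by move=> t; rewrite !inE => /orP[|/or4P[]] /eqP-> //; exact: Asym.
    - by move=> e; move: ux1; rewrite -e; lia.
  have qv : d q v <= 1 by apply/dN/qP; rewrite !inE eqxx.
  have qy : d q y2 <= 1 by apply/dN/qP; rewrite !inE eqxx ?orbT.
  have qz : d q z <= 1 by apply/dN/qP; rewrite !inE eqxx ?orbT.
  have uq : d u q <> k by have := dT z u q; rewrite (dC z q); lia.
  by have := off q _ _ _ _ v0 v2 b0 b2 isT uq; rewrite (dC v q); lia.
have [z0 [uz0 z00 z01]] := triangle_cond ux0 ux1 x0x1.
have [z1 [uz1 z11 z12]] := triangle_cond ux1 ux2 x1x2.
have [z02|z02] := EM (A z0 x2); first exact: (single z0).
have [z10|z10] := EM (A z1 x0); first exact: (single z1).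
have zz : A z0 z1.
  case: (clique_cond ux1 uz0 uz1 (Asym z01) (Asym z11)) => // e.
  by case: z02; rewrite e.
have [t [ut tz0 tz1]] := triangle_cond uz0 uz1 zz.
have [q qP] : exists q, forall s,
    s \in [:: t; x1; z1; z0; x0; y1; y2; x2] -> nbr q s.
  apply: dom6 => //; try exact: Asym;
    try (exact: low); try (exact: low'); try by move/Asym.
  - by move=> s; rewrite !inE => /orP[|/orP[|/or4P[]]] /eqP-> //; exact: Asym.
  - by move=> e; move: ux1; rewrite -e; lia.
have qt : d q t <= 1 by apply/dN/qP; rewrite !inE eqxx.
have qy : d q y1 <= 1 by apply/dN/qP; rewrite !inE eqxx ?orbT.
by have := dT t u q; have := dT q u y1; rewrite (dC t q); lia.
Qed.

Definition meeting_trivially u v w := forall z, btw u z v -> btw u z w -> z = u.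

(** If y were closer to u than v is, [descend] would give a first step from v shared
by geodesics to u and to y. *)
Lemma meeting_trivially_le u v w y :
  meeting_trivially v u w -> btw v y w -> d u v <= d u y.
Proof.
move=> triv b; rewrite leqNgt; apply/negP => /descend[x [vx xy ux]].
have bx : btw v x y by rewrite /btw (dA vx) add1n.
have e : x = v.
  apply: triv; last exact: btw_transl bx.
  by rewrite /btw (dA vx) (dC x u) (dC v u); lia.
by move: ux; rewrite e; lia.
Qed.

Lemma metric_triangle_flat u v w y :
  meeting_trivially v u w -> meeting_trivially w u v -> btw v y w ->
  d u y = d u v /\ d u w = d u v.
Proof.
move=> tv tw b; have le1 := meeting_trivially_le tv b.
have le2 := meeting_trivially_le tw (btw_sym b).
have bw : btw v w w by rewrite /btw gdistxx addn0.
have bv : btw w v v by rewrite /btw gdistxx addn0.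
have := meeting_trivially_le tv bw; have := meeting_trivially_le tw bv.
by have := ball_convex u b; lia.
Qed.

Lemma metric_triangle_small u v w :
  meeting_trivially u v w -> meeting_trivially v u w -> meeting_trivially w u v ->
  [/\ d u v = d v w, d u w = d v w & d v w <= 2].
Proof.
move=> tu tv tw.
have flat y : btw v y w -> d u y = d u v.
  by move=> b; case: (metric_triangle_flat tv tw b).
have bvv : btw v v w by rewrite /btw gdistxx.
have buu : btw u u w by rewrite /btw gdistxx.
have tw' : meeting_trivially w v u by move=> z ? ?; apply: tw.
have [_ e1] := metric_triangle_flat tv tw bvv.
have [_ e2] := metric_triangle_flat tu tw' buu.
rewrite (dC v u) in e2; split; try lia.
have [/(flat_side_small flat)|] := leqP 3 (d v w); lia.
Qed.

Lemma furthest_common w x y : exists z,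
  [/\ btw w z x, btw w z y & meeting_trivially z x y].
Proof.
pose P n := `[< exists z, [/\ btw w z x, btw w z y & d w z = n] >].
have exP : exists n, P n.
  by exists 0; apply/asboolP; exists w; rewrite /btw gdistxx.
have maxP n : P n -> n <= d w x.
  by move=> /asboolP[z [b _ <-]]; rewrite -b leq_addr.
case: (ex_maxnP exP maxP) => n /asboolP[z [zx zy zn]] max.
exists z; split=> // z' bx by_; apply/esym/d0.
have := max (d w z'); rewrite (_ : P _); last first.
  by apply/asboolP; exists z'; split=> //;
    [apply: btw_transr bx|apply: btw_transr by_].
move=> /(_ isT); move: bx zx (dT z' w x) (dT z w z'); rewrite /btw; lia.
Qed.

(** The Gromov product of x and y at w exceeds the distance from w to the corner z
of the triangle by half the side of that triangle, hence by at most 1. *)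
Lemma quasi_median w x y : exists z,
  [/\ btw w z x, btw w z y & d w x + d w y <= d x y + 2 * d w z + 2].
Proof.
have [w' [wx wy tw]] := furthest_common w x y.
have [x' [xw xy tx]] := furthest_common x w' y.
have [y' [yw yx ty]] := furthest_common y w' x'.
have tw' : meeting_trivially w' x' y'.
  move=> z zx zy; apply: tw.
    exact: btw_transl (btw_sym xw) zx.
  exact: btw_transl (btw_sym yw) zy.
have tx' : meeting_trivially x' w' y'.
  move=> z zx zy; apply: tx => //.
  exact: btw_transl (btw_sym yx) zy.
have [e1 e2 small] := metric_triangle_small tw' tx' ty.
exists w'; split=> //.
move: wx wy xw xy yw yx; rewrite /btw (dC x' w') (dC y' w') (dC y' x').
rewrite (dC x w') (dC y w') (dC x' y) (dC y y') (dC y x').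
lia.
Qed.

(** The quasi-medians of w, x, y and of w, y, z both lie on geodesics from w to y;
cut back to the same distance from w they are at distance at most 1. *)
Lemma four_point w x y z :
  d w y + d x z <= d w z + d x y + 3 \/ d w y + d x z <= d w x + d y z + 3.
Proof.
have [p [px py pm]] := quasi_median w x y.
have [q [qy qz qm]] := quasi_median w y z.
have core p' q' : btw w p' x -> btw w p' y -> btw w q' y -> btw w q' z ->
    d w p' = d w q' -> d x z + 2 * d w p' <= d w x + d w z + 1.
  move=> p'x p'y q'y q'z e; have := interval_thin p'y q'y e.
  move: p'x q'z; rewrite /btw => <- <-.
  by have := dT p' x z; have := dT q' p' z; rewrite (dC x p'); lia.
have cut t r : t <= d w r -> exists2 r', d w r' = t & btw w r' r.
  move=> le; have [r' e e'] := gdist_between le.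
  by exists r' => //; rewrite /btw; lia.
have [pq|/ltnW qp] := leqP (d w p) (d w q).
  have [q' e b] := cut _ _ pq.
  have := core p q' px py (btw_transl qy b) (btw_transl qz b) (esym e); left; lia.
have [p' e b] := cut _ _ qp.
by have := core p' q (btw_transl px b) (btw_transl py b) qy qz e; right; lia.
Qed.

End WeaklySystolic.

(** * Simply connected complexes *)

Section SimplyConnected.
Variables (W : choiceType) (Y : complex W).
Notation nbr := (closed_nbr (adj Y)).

Lemma connected_reach : connected Y ->
  forall x y, exists n, `[< reach (adj Y) n x y >].
Proof.
move=> con x y; have [p xp <-] := con x y.
exists (size p); apply/asboolP; elim: p x xp => [|z p IH] x //= [/face2 xz zp].
by exists z => //; apply: IH.
Qed.

Hypotheses (no4 : no_4wheel (adj Y)) (dom5 : dominated_5wheels (adj Y)).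
Let Asym := @adj_sym _ Y.
Let Airr := @adj_irr _ Y.

Section BasePoint.
Variable v : W.
Notation lifts := (lifts (adj Y) v).
Notation same := (same (adj Y) v).
Notation tip := (head v).

Lemma homotopic_lifts P Q s t : homotopic Y P Q -> lifts s P t <-> lifts s Q t.
Proof.
move=> h; elim: h s t => {P Q}
  [P|P Q _ IH|P Q S _ IH1 _ IH2|P x Q|P x y z Q f] s t //.
- by split=> /IH.
- by split=> [/IH1/IH2|/IH2/IH1].
- by split; apply: lifts_catl => u /(lifts_stutter Asym Airr no4 dom5).
- have [xy xz yz] : [/\ nbr x y, nbr x z & nbr y z].
    by split; apply: (face_nbr f); rewrite !inE eqxx ?orbT.
  have tri u := lifts_triangle Asym Airr no4 dom5 v u Q t xy xz yz.
  by split; apply: lifts_catl => u /tri.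
Qed.

Lemma lifts_edge_path s P t : lifts s P t -> edge_path Y (tip s) P.
Proof.
elim: P s => [|x P IH] s //= [u [su <- uP]]; split; last exact: IH.
by apply/face2/(near_nbr Asym).
Qed.

Hypothesis sc : simply_connected Y.

(** Going down from s to v and up to t is a loop, as both have the same tip, and its
lift at s ends at t. *)
Lemma tip_inj s t : same s s -> same t t -> tip s = tip t -> same s t.
Proof.
move=> ss tt e.
pose P := rcons s v ++ (rev t ++ [::]).
have sP : lifts s P t.
  apply: (lifts_down Asym); first by constructor 1.
  exact: (lifts_up tt (tt : lifts t [::] t)).
have loop : last (tip s) P = tip s.
  by rewrite (lifts_last sP).
have [_ /(_ _ _ (lifts_edge_path sP) loop) h] := sc.
have : lifts s (tip s :: P) t.
  by exists s; split=> //; constructor 1.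
move=> /(homotopic_lifts _ _ h)[u [su us ut]].
have /(near_full Asym Airr no4 dom5 su)[+ _] : near (adj Y) v s s by constructor 1.
by move=> /(_ us)/(same_sym Asym) {}us; apply: same_trans ut.
Qed.

Lemma tip_surj x : exists2 s, same s s & tip s = x.
Proof.
have [P vP <-] := sc.1 v x.
have H s : same s s -> edge_path Y (tip s) P -> exists t, lifts s P t.
  elim: P {vP} s => [|z P IH] s ss /=; first by exists s.
  move=> [/face2 sz zP].
  have [u su uz] : exists2 u, near (adj Y) v s u & tip u = z.
    case: sz => [<-|]; first by exists s => //; constructor 1.
    exact: (lift_nbr Asym Airr no4 dom5).
  have [|t ut] := IH u (near_same Asym su); first by rewrite uz.
  by exists t, u.
have [t st] := H [::] I vP.
by exists t; [exact: (lifts_same Asym st)|rewrite -(lifts_last st)].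
Qed.

End BasePoint.

Hypotheses (dom6 : dominated_6wheels (adj Y)) (sc : simply_connected Y).
Variable conn : forall x y, exists n, `[< reach (adj Y) n x y >].
Notation d := (gdist conn).

Lemma simply_connected_four_point w x y z :
  d w y + d x z <= d w z + d x y + 3 \/ d w y + d x z <= d w x + d y z + 3.
Proof.
have inj u := @tip_inj u sc; have surj u := @tip_surj u sc.
apply: (four_point Asym Airr _ _ no4 dom5 dom6) => u n a b.
  exact: (triangle_condition Asym Airr no4 dom5 (inj u) (surj u)).
move=> c; exact: (clique_condition Asym Airr no4 dom5 (inj u) (surj u)).
Qed.

End SimplyConnected.

(** * The metric of the 1-skeleton *)

Section Skeleton.
Import Order.TTheory GRing.Theory Num.Theory.
Local Open Scope fset_scope.
Local Open Scope ring_scope.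
Variables (R : realType) (W : choiceType) (Y : complex W).
Variable conn : forall x y, exists n, `[< reach (adj Y) n x y >].
Notation d := (gdist conn).
Notation nbr := (closed_nbr (adj Y)).
Notation path := (@skeleton1_path R W Y).
Implicit Types (e : {fset W}) (x y z : W -> R) (a b v : W).

Lemma edge_pair e : edge_or_vertex Y e -> exists a b, nbr a b /\ e = [fset a; b].
Proof.
move=> [fe e2]; have /fset0Pn[a ae] := face_neq0 fe.
have [[b be ab]|no] := EM (exists2 b, b \in e & b != a).
  exists a, b; split; first exact: face_nbr fe ae be.
  apply/esym/eqP; rewrite eqEfcard; apply/andP; split; last first.
    by rewrite cardfs2 eq_sym ab.
  by apply/fsubsetP => c; rewrite !inE => /orP[] /eqP->.
exists a, a; split; first by left.
apply/fsetP => b; rewrite !inE orbb; apply/idP/eqP => [be|->//].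
by apply/eqP/negPn/negP => ba; apply: no; exists b.
Qed.

Definition vertex_point a : W -> R := fun v => (v == a)%:R.

Lemma vertex_barycentric e a : a \in e -> barycentric e (vertex_point a).
Proof.
move=> ae; split=> [v|v ve|]; first by rewrite /vertex_point; case: eqP.
  by rewrite /vertex_point; case: eqP ve => // ->; rewrite ae.
rewrite (big_fsetD1 a) //= /vertex_point eqxx big_seq big1 ?addr0 // => v.
by rewrite !inE => /andP[/negbTE->].
Qed.

Lemma path_cat x y z l m : path x y l -> path y z m -> path x z (l + m).
Proof.
move=> xy; elim: xy m => {x y l} [x|e x y w l ee ex ey _ IH] m wz.
  by rewrite add0r.
by rewrite -addrA; apply: skeleton1_path_cons ex ey (IH _ wz).
Qed.

Lemma segment_length e x y : barycentric e x -> barycentric e y ->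
  (\sum_(v <- e) `|x v - y v|) / 2 <= 1.
Proof.
move=> [x0 _ x1] [y0 _ y1].
rewrite ler_pdivrMr // mul1r.
apply: (@le_trans _ _ (\sum_(v <- e) (x v + y v))).
  apply: ler_sum => v _; apply: (le_trans (ler_normB _ _)).
  by rewrite !ger0_norm.
by rewrite big_split /= x1 y1.
Qed.

Lemma segment_path e x y :
  edge_or_vertex Y e -> barycentric e x -> barycentric e y ->
  exists2 l, path x y l & l <= 1.
Proof.
move=> ee ex ey; exists ((\sum_(v <- e) `|x v - y v|) / 2 + 0).
  by apply: skeleton1_path_cons ee ex ey _; apply: skeleton1_path_nil.
by rewrite addr0; apply: segment_length.
Qed.

Lemma reach_path n a b : reach (adj Y) n a b ->
  exists2 l, path (vertex_point a) (vertex_point b) l & l <= n%:R.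
Proof.
elim: n a => [|n IH] a /=.
  by move->; exists 0 => //; apply: skeleton1_path_nil.
move=> [c ac /IH[m cb mn]].
have [|||l cl l1] := @segment_path [fset a; c] (vertex_point a) (vertex_point c).
- by split; [apply/face2|rewrite cardfs2; case: (_ != _)].
- by apply: vertex_barycentric; rewrite !inE eqxx.
- by apply: vertex_barycentric; rewrite !inE eqxx orbT.
exists (l + m); first exact: path_cat cl cb.
by rewrite -natr1; lra.
Qed.

(** The affine extension to the edge e of a function D on vertices. If D varies by
at most one along edges, it is 1-Lipschitz; taking for D the distance to a fixed
vertex bounds lengths from below. *)
Definition potential (D : W -> R) e x : R := \sum_(v <- e) x v * D v.

Lemma potential_support D e e' x : barycentric e x -> barycentric e' x ->
  potential D e x = potential D e' x.
Proof.
suff H f f' : barycentric f x -> potential D f x = potential D (f `|` f') x.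
  by move=> ex ex'; rewrite (H e e') // (H e' e) // fsetUC.
move=> [_ x0 _]; apply: big_fset_incl => [|v _ vf]; first exact: fsubsetUl.
by rewrite x0 // mul0r.
Qed.

Lemma potential_segment D e x y :
  (forall a b, nbr a b -> `|D a - D b| <= 1) ->
  edge_or_vertex Y e -> barycentric e x -> barycentric e y ->
  `|potential D e x - potential D e y| <= (\sum_(v <- e) `|x v - y v|) / 2.
Proof.
move=> lip /edge_pair[a [b [ab ee]]] [x0 _ x1] [y0 _ y1].
(* Centring D at the middle of its two values uses that both points have total
   mass 1, and leaves weights of size at most 1/2. *)
pose c := (D a + D b) / 2.
have -> : potential D e x - potential D e y = \sum_(v <- e) (x v - y v) * (D v - c).
  transitivity (\sum_(v <- e) (x v * D v - y v * D v - (x v - y v) * c)).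
    by rewrite !sumrB -!mulr_suml sumrB x1 y1 subrr mul0r subr0.
  by apply: eq_bigr => v _; ring.
rewrite mulr_suml; apply: (le_trans (ler_norm_sum _ _ _)).
rewrite !big_seq; apply: ler_sum => v ve; rewrite normrM ler_wpM2l //.
have := lip _ _ ab; move: ve; rewrite ee /c !inE => /orP[] /eqP->;
  rewrite !ler_norml => /andP[h1 h2]; apply/andP; split; lra.
Qed.

Lemma potential_path D x z l e e' :
  (forall a b, nbr a b -> `|D a - D b| <= 1) ->
  path x z l -> barycentric e x -> barycentric e' z ->
  `|potential D e x - potential D e' z| <= l.
Proof.
move=> lip xz; elim: xz e e' => {x z l} [x|f x y z l fe fx fy _ IH] e e' ex ez.
  by rewrite (potential_support D ex ez) subrr normr0.
rewrite (potential_support D ex fx).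
have := IH _ _ fy ez; have := potential_segment lip fe fx fy.
rewrite !ler_norml => /andP[? ?] /andP[? ?]; apply/andP; split; lra.
Qed.

Lemma path_ge x y l e e' a b : edge_or_vertex Y e -> edge_or_vertex Y e' ->
  barycentric e x -> barycentric e' y -> a \in e -> b \in e' ->
  path x y l -> (d a b)%:R - 2 <= l.
Proof.
move=> [fe _] [fe' _] ex ey ae be xy.
pose D v : R := (d a v)%:R.
have nat1 m n : (m <= n.+1)%N -> m%:R <= n%:R + 1 :> R.
  by move=> mn; rewrite natr1 ler_nat.
have lip v w : nbr v w -> `|D v - D w| <= 1.
  move=> /(gdist_nbr conn) vw.
  have v1 : D v <= D w + 1.
    apply: nat1; rewrite -addn1; apply: leq_trans (gdist_triangle conn w a v) _.
    by rewrite leq_add2l (gdist_sym (@adj_sym _ Y)).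
  have w1 : D w <= D v + 1.
    apply: nat1; rewrite -addn1; apply: leq_trans (gdist_triangle conn v a w) _.
    by rewrite leq_add2l.
  by rewrite ler_norml; apply/andP; split; lra.
have := potential_path lip xy ex ey.
have le1 : potential D e x <= 1.
  case: ex => x0 _ <-; rewrite /potential !big_seq; apply: ler_sum => v ve.
  rewrite -[leRHS]mulr1 ler_wpM2l // (ler_nat _ _ 1).
  by apply/gdist_nbr; apply: face_nbr fe ae ve.
have ge1 : (d a b)%:R - 1 <= potential D e' y.
  case: ey => y0 _ y1.
  rewrite -[leLHS]mul1r -[X in X * _]y1 mulr_suml /potential !big_seq.
  apply: ler_sum => v ve; rewrite ler_wpM2l //.
  have /lip : nbr v b by apply: face_nbr fe' ve be.
  by rewrite ler_norml => /andP[]; rewrite /D; lra.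
rewrite ler_norml => /andP[]; lra.
Qed.

(** Moving from a point of an edge to one of its ends costs at most 1. *)
Lemma path_metric_approx x y e e' a b : edge_or_vertex Y e -> edge_or_vertex Y e' ->
  barycentric e x -> barycentric e' y -> a \in e -> b \in e' ->
  `|path_metric Y x y - (d a b)%:R| <= 2.
Proof.
move=> ee ee' ex ey ae be.
have lower l : path x y l -> (d a b)%:R - 2 <= l.
  by move=> xy; apply: (path_ge ee ee' ex ey ae be xy).
have [l1 p1 l1n] := segment_path ee ex (vertex_barycentric ae).
have [l2 p2 l2n] := reach_path (gdist_reach conn a b).
have [l3 p3 l3n] := segment_path ee' (vertex_barycentric be) ey.
have p := path_cat p1 (path_cat p2 p3).
have lb : has_lbound [set l | path x y l]%classic.
  by exists ((d a b)%:R - 2) => l /= /lower.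
have up : path_metric Y x y <= l1 + (l2 + l3) by apply: ge_inf.
have lo : (d a b)%:R - 2 <= path_metric Y x y.
  by apply: lb_le_inf => [|l /= /lower//]; exists (l1 + (l2 + l3)).
by rewrite ler_norml; apply/andP; split; lra.
Qed.

Lemma four_point_hyperbolic :
  (forall o a b c, (d o b + d a c <= d o c + d a b + 3)%N \/
                   (d o b + d a c <= d o a + d b c + 3)%N) ->
  hyperbolic_complex R Y.
Proof.
move=> four.
(* Six distances are each off by 2, of which four enter: (3 + 8) / 2 < 6. *)
exists 6 => x y z w [ex eex bx] [ey eey by_] [ez eez bz] [ew eew bw].
have pick e : edge_or_vertex Y e -> exists a, a \in e.
  by move=> [/face_neq0/fset0Pn].
have [a ax] := pick _ eex; have [b by'] := pick _ eey.
have [c cz] := pick _ eez; have [o ow] := pick _ eew.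
have := path_metric_approx eew eex bw bx ow ax.
have := path_metric_approx eew eey bw by_ ow by'.
have := path_metric_approx eew eez bw bz ow cz.
have := path_metric_approx eex eey bx by_ ax by'.
have := path_metric_approx eey eez by_ bz by' cz.
have := path_metric_approx eex eez bx bz ax cz.
rewrite !ler_norml /gromov_product; do 6 move=> /andP[? ?].
rewrite lerBlDr ge_min; apply/orP.
case: (four o a b c); rewrite -(ler_nat R) !natrD => h; [left|right]; lra.
Qed.

End Skeleton.

(** * Hyperbolicity of the universal cover *)

Theorem theoremD (R : realType) (V : choiceType) (X : complex V)
    (X_connected : connected X) (X_cliques : no_infinite_clique X)
    (X_SD2star : SD2star 7 X)
    (W : choiceType) (Y : complex W) (p : W -> V)
    (p_universal : universal_cover Y X p) :
  hyperbolic_complex R Y.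
Proof.
have [p_cover Y_sc] := p_universal; have [X_flag _ _] := X_SD2star.
have Y_SD2star : SD2star 7 Y := SD2star_cover X_flag p_cover X_SD2star.
have conn := connected_reach Y_sc.1.
apply: (@four_point_hyperbolic R W Y conn).
apply: simply_connected_four_point => //.
- exact: SD2star_no_4wheel Y_SD2star.
- exact: SD2star_5wheel Y_SD2star.
- exact: SD2star_6wheel Y_SD2star.
Qed.
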